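(* Let $R$ be a commutative Noetherian ring with non-zero identity, $\mathfrak a$ an ideal of $R$, $M$ a finitely generated $R$-module, $X$ an arbitrary $R$-module and $n$ a non-negative integer. Then: (a) $\displaystyle\bigcup_{i\le n}\operatorname{Supp}_R(H^i_{\mathfrak a}(M,X))=\bigcup_{i\le n}\operatorname{Supp}_R(H^i_{\mathfrak a+\operatorname{Ann}_RM}(X))$. (b) $\displaystyle\bigcup_{i\le n}\operatorname{Supp}_R(H^i_{\mathfrak a}(M,X))=\bigcup_{i\le n}\operatorname{Supp}_R(\operatorname{Ext}^i_R(M/\mathfrak aM,X))$. (c) $\displaystyle\bigcup_{i\le n}\operatorname{Supp}_R(H^i_{\mathfrak a}(M,X))$ is a closed set (in $\operatorname{Spec}R$) when $X$ is a finitely generated $R$-module. (d) $\displaystyle\bigcup_{i}\operatorname{Supp}_R(H^i_{\mathfrak a}(M,X))$ is a closed set (in $\operatorname{Spec}R$) when $X$ is a finitely generated $R$-module. In particular, $\operatorname{Supp}_R(H^n_{\mathfrak a}(M,X))\subseteq\displaystyle\bigcup_{i\le\operatorname{cd}_R(\mathfrak a+\operatorname{Ann}_RM,X)}\operatorname{Supp}_R(H^i_{\mathfrak a}(M,X))$.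
   Context: $H^i_{\mathfrak a}(M,X)=\varinjlim_{k}\operatorname{Ext}^i_R(M/\mathfrak a^kM,X)$ is the $i$-th generalized local cohomology module, and for an ideal $\mathfrak b$, $H^i_{\mathfrak b}(X)=H^i_{\mathfrak b}(R,X)$ is ordinary local cohomology. $\operatorname{cd}_R(\mathfrak b,X)$, the cohomological dimension of $X$ with respect to $\mathfrak b$, is the largest integer $i$ with $H^i_{\mathfrak b}(X)\ne 0$. *)

(* Defs.v *)
From HB Require Import structures.
From mathcomp Require Import all_boot all_order all_algebra.
From mathcomp Require Import generic_quotient ring_quotient.
From mathcomp Require Import all_classical constructive_ereal.
From mathcomp Require Import ring.

Set Implicit Arguments.
Unset Strict Implicit.
Unset Printing Implicit Defensive.

Import Order.TTheory GRing.Theory Num.Theory.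

Local Open Scope classical_set_scope.
Local Open Scope quotient_scope.
Local Open Scope ring_scope.

Notation ideal R := (submodClosed R^o).

Section SubQuot.
Variables (R : pzRingType) (V : lmodType R) (S : submodClosed V).

Definition subm := {x : V | x \in (S : {pred V})}.

HB.instance Definition _ := SubChoice.on subm.
HB.instance Definition _ :=
  GRing.SubChoice_isSubLmodule.Build R V (S : {pred V}) subm
    (submodClosedP S).

(* [submodClosed V] does not inherit from [zmodClosed V] in the library. *)
Definition zmod_of : {pred V} := S.
HB.instance Definition _ :=
  GRing.isZmodClosed.Build V zmod_of (GRing.submod_closedB (submodClosedP S)).

Definition quotm := Quotient.quot zmod_of.
HB.instance Definition _ := GRing.Zmodule.on quotm.
HB.instance Definition _ := EqQuotient.on quotm.

Lemma eqquotmE (x y : V) :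
  (x == y %[mod quotm]) = (x - y \in (S : {pred V})).
Proof. by rewrite -(Quotient.idealrBE zmod_of). Qed.

Lemma pi_addq : {morph \pi_quotm : x y / x + y >-> x + y}.
Proof. exact: Quotient.pi_add. Qed.

Definition scaleq (a : R) : quotm -> quotm := lift_op1 quotm ( *:%R a).

Lemma pi_scale a : {morph \pi_quotm : x / a *: x >-> scaleq a x}.
Proof.
move=> x; unlock scaleq; apply/eqP; rewrite eqquotmE -scalerBr rpredZ//.
by rewrite -eqquotmE reprK.
Qed.

Lemma scaleqA a b v : scaleq a (scaleq b v) = scaleq (a * b) v.
Proof. by rewrite -[v]reprK -!pi_scale scalerA. Qed.
Lemma scaleq1 : left_id 1 scaleq.
Proof. by move=> v; rewrite -[v]reprK -!pi_scale scale1r. Qed.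
Lemma scaleqDr : right_distributive scaleq +%R.
Proof.
move=> a u v; rewrite -[u]reprK -[v]reprK -!pi_scale.
by rewrite -?pi_addq -pi_scale scalerDr.
Qed.
Lemma scaleqDl v : {morph scaleq^~ v : a b / a + b}.
Proof.
by move=> a b; rewrite -[v]reprK -!pi_scale -pi_addq scalerDl.
Qed.
HB.instance Definition _ :=
  GRing.Zmodule_isLmodule.Build R quotm scaleqA scaleq1 scaleqDr scaleqDl.

Definition proj : V -> quotm := \pi_quotm.
Lemma proj_linear : linear proj.
Proof. by move=> a x y; rewrite /proj pi_addq pi_scale. Qed.
HB.instance Definition _ := GRing.isLinear.Build R V quotm _ proj proj_linear.

Lemma proj_surj z : exists x, proj x = z.
Proof. by exists (repr z); rewrite /proj reprK. Qed.
Lemma proj_eq0 x : (proj x == 0) = (x \in (S : {pred V})).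
Proof.
rewrite -[in LHS](linear0 proj) /proj.
by rewrite eqquotmE subr0.
Qed.

End SubQuot.

Definition mkLin (R : pzRingType) (V W : lmodType R) (f : V -> W)
    (fL : linear f) : {linear V -> W} :=
  HB.pack f (GRing.isLinear.Build R V W *:%R f fL).

Section Lift.
Variables (R : pzRingType) (V W : lmodType R) (S : submodClosed V).
Variables (f : {linear V -> W}) (f0 : forall x, x \in S -> f x = 0).

Lemma qlift_linear : linear (fun z : quotm S => f (repr z)).
Proof.
move=> a x y; rewrite -linearP; apply/eqP; rewrite -subr_eq0 -linearB.
by apply/eqP/f0; rewrite -eqquotmE reprK pi_addq pi_scale !reprK.
Qed.

Definition qlift : {linear quotm S -> W} := mkLin qlift_linear.

Lemma qliftE x : qlift (proj S x) = f x.
Proof.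
apply/eqP; rewrite -subr_eq0 /= -linearB; apply/eqP/f0.
by rewrite -eqquotmE reprK.
Qed.
End Lift.

Section Span.
Variables (R : pzRingType) (V : lmodType R).

Definition span (A : set V) : {pred V} :=
  [pred x | `[< exists2 s : seq (R * V), (forall p, p \in s -> A p.2)
                & x = \sum_(p <- s) p.1 *: p.2 >]].

Lemma span_submod A : submod_closed (span A).
Proof.
split=> [|c x y]; first by apply/asboolP; exists [::] => //; rewrite big_nil.
move=> /asboolP[s sA ->] /asboolP[t tA ->]; apply/asboolP.
exists ([seq (c * p.1, p.2) | p <- s] ++ t) => [p|].
  by rewrite mem_cat => /orP[/mapP[q /sA Aq ->]//|/tA].
rewrite big_cat big_map scaler_sumr; congr (_ + _).
by apply: eq_bigr => p _; rewrite scalerA.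
Qed.
HB.instance Definition _ A :=
  GRing.isSubmodClosed.Build R V (span A) (span_submod A).

Definition fin_gen := exists s : seq V, forall x : V, x \in span [set` s].

End Span.

Section Ideals.
Variable R : comNzRingType.

Definition noetherian :=
  forall a : ideal R, exists s : seq R^o,
    forall x : R^o, (x \in a) = (x \in span [set` s]).

(* The products r *: y with r in a and y in S generate aS. *)
Definition mulsm (V : lmodType R) (a : ideal R) (S : set V) : submodClosed V :=
  span [set x | exists r y, [/\ r \in a, S y & x = (r : R) *: y]].

(* [span setT] is the unit ideal, a^0. *)
Fixpoint idealX (a : ideal R) (k : nat) : ideal R :=
  if k is j.+1 then mulsm a [set` idealX a j] else span setT.

Definition idealD (a b : ideal R) : ideal R := span ([set` a] `|` [set` b]).

Definition annih (V : lmodType R) : {pred R^o} :=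
  [pred r : R^o | `[< forall x : V, (r : R) *: x = 0 >]].
Lemma annih_submod V : submod_closed (annih V).
Proof.
split=> [|c r s]; first by apply/asboolP => x; rewrite scale0r.
move=> /asboolP r0 /asboolP s0; apply/asboolP => x.
by rewrite scalerDl s0 addr0 -scalerA r0 scaler0.
Qed.
HB.instance Definition _ V :=
  GRing.isSubmodClosed.Build R R^o (annih V) (annih_submod V).
End Ideals.

Section Complexes.
Variable R : comNzRingType.

Record cochain := Cochain {
  cobj :> nat -> lmodType R;
  cdiff : forall i, {linear cobj i -> cobj i.+1};
  cdiffK : forall i x, cdiff i.+1 (cdiff i x) = 0 }.

Section Cohomology.
Variables (C : cochain) (i : nat).

Definition cocycle : {pred C i} := [pred x | cdiff C i x == 0].
Lemma cocycle_submod : submod_closed cocycle.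
Proof.
split=> [|c x y]; rewrite !inE ?linear0// => /eqP x0 /eqP y0.
by rewrite linearP x0 y0 scaler0 addr0.
Qed.
HB.instance Definition _ :=
  GRing.isSubmodClosed.Build R (C i) cocycle cocycle_submod.

Definition is_coboundary : C i -> Prop :=
  match i return C i -> Prop with
  | 0 => fun x => x = 0
  | j.+1 => fun x => exists y, x = cdiff C j y
  end.
Lemma is_coboundary0 : is_coboundary 0.
Proof.
by rewrite /is_coboundary; case: i => // j; exists 0; rewrite linear0.
Qed.
Lemma is_coboundaryP c x y :
  is_coboundary x -> is_coboundary y -> is_coboundary (c *: x + y).
Proof.
rewrite /is_coboundary; case: i x y => [x y -> ->|j x y [u ->] [v ->]].
  by rewrite scaler0 addr0.
by exists (c *: u + v); rewrite linearP.
Qed.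

Definition coboundary : {pred subm cocycle} :=
  [pred z | `[< is_coboundary (val z) >]].
Lemma coboundary_submod : submod_closed coboundary.
Proof.
split=> [|c x y]; first exact/asboolP/is_coboundary0.
by move=> /asboolP xB /asboolP yB; apply/asboolP/is_coboundaryP.
Qed.
HB.instance Definition _ :=
  GRing.isSubmodClosed.Build R (subm cocycle) coboundary coboundary_submod.

(* Cocycles modulo coboundaries; the cochain complex starts in degree 0. *)
Definition cohomology : lmodType R := quotm coboundary.

End Cohomology.

Record cochain_map (C D : cochain) := CochainMap {
  cmap :> forall i, {linear C i -> D i};
  cmapE : forall i x, cmap i.+1 (cdiff C i x) = cdiff D i (cmap i x) }.

Section CohomologyMap.
Variables (C D : cochain) (f : cochain_map C D) (i : nat).

Lemma cocycle_map (z : subm (cocycle (C := C) (i := i))) :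
  f i (val z) \in cocycle (C := D) (i := i).
Proof.
by rewrite inE -cmapE; have := valP z; rewrite inE => /eqP->; rewrite linear0.
Qed.

Definition cocycle_fun z : cohomology D i :=
  proj (coboundary (C := D) (i := i)) (Sub (f i (val z)) (cocycle_map z)).

Lemma cocycle_fun_linear : linear cocycle_fun.
Proof.
move=> c x y; rewrite -linearP; congr (proj _ _).
by apply: val_inj; rewrite /= !linearP.
Qed.

Lemma is_coboundary_map (x : C i) : is_coboundary x -> is_coboundary (f i x).
Proof.
rewrite /is_coboundary; case: i x => [x ->|j x [y ->]]; first exact: linear0.
by exists (f j y); rewrite cmapE.
Qed.

Lemma cocycle_fun0 z : z \in coboundary (C := C) (i := i) ->
  mkLin cocycle_fun_linear z = 0.
Proof.
move=> /asboolP zB; apply/eqP; rewrite proj_eq0.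
exact/asboolP/is_coboundary_map.
Qed.

Definition cohomology_map : {linear cohomology C i -> cohomology D i} :=
  qlift cocycle_fun0.
End CohomologyMap.

Implicit Types M N L : lmodType R.

Definition is_linear (M N : lmodType R) : {pred M -> N} :=
  [pred f : M -> N | `[< linear f >]].
Lemma is_linear_submod M N : submod_closed (@is_linear M N).
Proof.
split=> [|c f g]; first by apply/asboolP => a x y /=; rewrite scaler0 addr0.
move=> /asboolP fL /asboolP gL; apply/asboolP => a x y.
rewrite !fctE /= fL gL !scalerDr !scalerA mulrC -!addrA; congr (_ + _).
by rewrite addrCA.
Qed.
HB.instance Definition _ (M N : lmodType R) :=
  GRing.isSubmodClosed.Build R (M -> N) (@is_linear M N)
    (@is_linear_submod M N).

Definition Hom (M N : lmodType R) : lmodType R := subm (@is_linear M N).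

Lemma homP M N (f : Hom M N) : linear (val f).
Proof. exact/asboolP/(valP f). Qed.

Lemma comp_hom M' M N N' (g : {linear N -> N'}) (h : {linear M' -> M})
    (f : Hom M N) : g \o val f \o h \in @is_linear M' N'.
Proof. by apply/asboolP => a x y /=; rewrite linearP homP linearP. Qed.

Definition hom_fun M' M N N' (g : {linear N -> N'}) (h : {linear M' -> M})
  (f : Hom M N) : Hom M' N' := Sub (g \o val f \o h) (comp_hom g h f).
Lemma hom_fun_linear M' M N N' (g : {linear N -> N'}) (h : {linear M' -> M}) :
  linear (hom_fun g h).
Proof.
move=> a f f'; apply: val_inj; apply/funext => x /=.
by rewrite linearP.
Qed.
Definition hom_map M' M N N' (g : {linear N -> N'}) (h : {linear M' -> M}) :
  {linear Hom M N -> Hom M' N'} := mkLin (hom_fun_linear g h).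

Lemma hom_diffK N (C : cochain) i (f : Hom N (C i)) :
  hom_map (cdiff C i.+1) idfun (hom_map (cdiff C i) idfun f) = 0.
Proof. by apply: val_inj; apply/funext => x /=; rewrite cdiffK. Qed.

Definition hom_cochain N (C : cochain) : cochain :=
  Cochain (@hom_diffK N C).

Lemma hom_precompE N N' (h : {linear N' -> N}) (C : cochain) i
    (f : hom_cochain N C i) :
  hom_map idfun h (cdiff (hom_cochain N C) i f) =
  cdiff (hom_cochain N' C) i (hom_map idfun h f).
Proof. exact: val_inj. Qed.

Definition hom_precomp N N' (h : {linear N' -> N}) (C : cochain) :
    cochain_map (hom_cochain N C) (hom_cochain N' C) :=
  @CochainMap (hom_cochain N C) (hom_cochain N' C)
    (fun i => hom_map idfun h) (@hom_precompE N N' h C).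

Definition injective_module (E : lmodType R) :=
  forall (A B : lmodType R) (f : {linear A -> B}) (g : {linear A -> E}),
    injective f -> exists h : {linear B -> E}, forall x, h (f x) = g x.

Record injective_resolution (X : lmodType R) := InjectiveResolution {
  ires :> cochain;
  iaug : {linear X -> ires 0};
  ires_injective : forall i, injective_module (ires i);
  iaug_inj : injective iaug;
  iaug_exact : forall y, cdiff ires 0 y = 0 <-> exists x, y = iaug x;
  ires_exact : forall i y,
    cdiff ires i.+1 y = 0 <-> exists x, y = cdiff ires i x }.

End Complexes.

Section ExtendAdditive.
Variables (B D : zmodType).
Hypothesis divD : forall (d : D) (n : nat), (0 < n)%N -> exists e, e *+ n = d.

Definition graph (G : set (B * D)) :=
  [/\ G 0, forall u v, G u -> G v -> G (u - v) & forall d, G (0, d) -> d = 0].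

Lemma graphN G u : graph G -> G u -> G (- u).
Proof. by case=> G0 GB _ Gu; rewrite -sub0r; exact: GB. Qed.

Lemma graphD G u v : graph G -> G u -> G v -> G (u + v).
Proof.
move=> gG Gu Gv; rewrite -[v]opprK; case: (gG) => _ + _.
by apply=> //; exact: graphN.
Qed.

Lemma graphM G u (k : int) : graph G -> G u -> G (u *~ k).
Proof.
move=> gG Gu; have GM n : G (u *+ n).
  elim: n => [|n IHn]; first by case: gG.
  by rewrite mulrS; exact: graphD.
case: k => n; first exact: GM.
by rewrite NegzE mulrNz; apply: graphN => //; exact: GM.
Qed.

Lemma graph_gen G b : graph G -> exists (m : nat) (d : D),
  G (b *+ m, d *+ m) /\ forall (k : int) c, G (b *~ k, c) -> (m %| k)%Z.
Proof.
move=> gG; have [G0 GB Gfun] := gG.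
have [[n [n0 [c Gc]]]|noc] :=
    pselect (exists n : nat, (0 < n)%N /\ exists c, G (b *+ n, c)); last first.
  exists 0%N, 0; split=> // k c Gc; rewrite dvd0z; apply: contra_notT noc => k0.
  exists `|k|%N; split; first by rewrite absz_gt0.
  case: k k0 Gc => k k0 Gc; first by exists c.
  exists (- c); have : G (- (b *~ Negz k), - c) := graphN gG Gc.
  by rewrite !NegzE mulrNz opprK abszN.
have exn : exists n, `[< (0 < n)%N /\ exists c, G (b *+ n, c) >].
  by exists n; apply/asboolP; split=> //; exists c.
case: (ex_minnP exn) => m /asboolP[m0 [e Ge]] mmin.
have [d dm] := divD e m0.
exists m, d; split; first by rewrite dm.
move=> k f Gf; apply/dvdz_mod0P.
have r0 : (0 <= (k %% m)%Z) by rewrite modz_ge0// -lt0n.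
have rm : ((k %% m)%Z < m) by rewrite ltz_pmod.
have Gr : G (b *~ (k %% m)%Z, f - e *~ (k %/ m)%Z).
  have := GB _ _ Gf (graphM (k %/ m)%Z gG Ge).
  have -> : (b *+ m, e) *~ (k %/ m)%Z =
      (b *~ (m%:Z * (k %/ m)%Z), e *~ (k %/ m)%Z).
    by apply: injective_projections; rewrite raddfMz//= pmulrn -mulrzA.
  rewrite [X in G X](_ : _ = (b *~ k - b *~ (m%:Z * (k %/ m)%Z),
    f - e *~ (k %/ m)%Z))//.
  by rewrite -mulrzBr; congr G; congr pair; congr (b *~ _); rewrite /modz mulrC.
case: (k %% m)%Z r0 rm Gr => // -[//|r] _ rm Gr.
suff : (m <= r.+1)%N by rewrite leqNgt; case/negP.
apply: mmin; apply/asboolP; split=> //; by exists (f - e *~ (k %/ m)%Z).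
Qed.

Lemma graph_extend G b : graph G ->
  exists2 A, graph A & G `<=` A /\ exists c, A (b, c).
Proof.
move=> gG; have [G0 GB Gfun] := gG; have [m [d [Gm mdvd]]] := graph_gen b gG.
exists [set u | exists (v : B * D) (k : int),
  G v /\ u = (v.1 + b *~ k, v.2 + d *~ k)]; last split.
- split=> [|u v [u' [k [Gu ->]]] [v' [l [Gv ->]]]|c [[v1 v2] [k [Gv [e1 ->]]]]].
  + by exists 0, 0; split=> //; rewrite !mulr0z !addr0.
  + exists (u' - v'), (k - l); split; first exact: GB.
    by apply: injective_projections; rewrite /= mulrzBr opprD addrACA.
  + have /dvdzP[q kE] : (m %| k)%Z.
      apply: (mdvd _ (- v2)).
      have : G (- v1, - v2) := graphN gG Gv.
      by rewrite (_ : b *~ k = - v1)//; apply/eqP; rewrite -addr_eq0 addrC -e1.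
    apply: Gfun; have := graphD gG Gv (graphM q gG Gm).
    have -> : (b *+ m, d *+ m) *~ q = (b *~ k, d *~ k).
      apply: injective_projections; rewrite raddfMz /= kE.
        by rewrite pmulrn -mulrzA mulrC.
      by rewrite pmulrn -mulrzA mulrC.
    by rewrite e1.
- by move=> u Gu; exists u, 0; split=> //; rewrite !mulr0z !addr0; case: (u).
- by exists d, 0, 1; split=> //=; rewrite !mulr1z !add0r.
Qed.

Lemma additive_extension G : graph G ->
  exists h : {additive B -> D}, forall b d, G (b, d) -> h b = d.
Proof.
move=> gG; pose P A := A = set0 \/ (graph A /\ G `<=` A).
have [|A [PA Amax]] := @Zorn_bigcup _ P.
  move=> F FP Ftot.
  have [FE|] := pselect (forall X, F X -> X = set0).
    by left; rewrite -subset0 => x [X /FE -> []].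
  move=> /existsNP[X0 /not_implyP[FX0 X0n]]; right.
  have [//|[gX0 GX0]] := FP _ FX0.
  have FG X u : F X -> X u -> graph X.
    by move=> /FP[-> []|[]].
  split; last by move=> u Gu; exists X0 => //; exact: GX0.
  split; first by exists X0 => //; case: gX0.
    move=> u v [X FX Xu] [Y FY Yv].
    have [XY|YX] := Ftot _ _ FX FY.
      by exists Y => //; case: (FG _ _ FY Yv) => _ + _; apply=> //; exact: XY.
    by exists X => //; case: (FG _ _ FX Xu) => _ + _; apply=> //; exact: YX.
  by move=> d [X FX Xd]; case: (FG _ _ FX Xd) => _ _; exact.
have {PA} [gA GA] : graph A /\ G `<=` A.
  case: PA => // A0; exfalso; apply: (Amax G); last by right; split.
  by rewrite A0; split=> // /(_ 0); apply; case: gG.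
have Adom b : exists c, A (b, c).
  have [A' gA' [AA' [c A'c]]] := graph_extend b gA.
  suff -> : A = A' by exists c.
  apply/seteqP; split=> //; apply: contrapT => nA'A.
  by apply: (Amax A'); [split|right; split=> //; exact: subset_trans AA'].
pose h b := projT1 (cid (Adom b)).
have hP b : A (b, h b) := projT2 (cid (Adom b)).
have hE b c : A (b, c) -> h b = c.
  move=> Ac; apply/eqP; rewrite -subr_eq0; apply/eqP; case: gA => _ AB; apply.
  by rewrite -[0](subrr b); exact: (AB _ _ (hP b) Ac).
have hB : zmod_morphism h.
  by move=> x y; apply: hE; case: gA => _ AB _; exact: (AB _ _ (hP x) (hP y)).
pose h' : {additive B -> D} := HB.pack h (GRing.isZmodMorphism.Build B D h hB).
by exists h' => b d /GA /hE.
Qed.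
End ExtendAdditive.

Section CharacterModule.

Definition ratZ : {pred rat} := [pred q | q \is a Num.int].
Lemma ratZ_zmod : zmod_closed ratZ.
Proof. by split=> [|p q pZ qZ]; rewrite !inE ?rpred0// rpredB. Qed.
HB.instance Definition _ := GRing.isZmodClosed.Build rat ratZ ratZ_zmod.

Definition QZ : zmodType := Quotient.quot ratZ.
Definition piQZ (q : rat) : QZ := \pi_(Quotient.quot ratZ) q.

Lemma piQZ_zmod : zmod_morphism piQZ.
Proof.
move=> p q; rewrite /piQZ [LHS]Quotient.pi_add; congr (_ + _).
exact: Quotient.pi_opp.
Qed.
HB.instance Definition _ := GRing.isZmodMorphism.Build rat QZ piQZ piQZ_zmod.

Lemma piQZ_eq0 q : (piQZ q == 0) = (q \is a Num.int).
Proof.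
rewrite -(raddf0 piQZ); have := Quotient.idealrBE ratZ q 0.
by rewrite subr0 => <-.
Qed.

Lemma QZ_div (d : QZ) (n : nat) : (0 < n)%N -> exists e, e *+ n = d.
Proof.
move=> n0; have [q <-] : exists q, piQZ q = d by exists (repr d); exact: reprK.
exists (piQZ (q / n%:R)).
rewrite -raddfMn; congr piQZ.
by rewrite -[LHS]mulr_natr divfK// pnatr_eq0 -lt0n.
Qed.

Lemma character_neq0 (V : zmodType) (x : V) : x != 0 ->
  exists chi : {additive V -> QZ}, chi x != 0.
Proof.
move=> x0.
have g0 : graph [set (0 : V * QZ)].
  by split=> // [u v -> ->|d [->//]]; rewrite subrr.
have [m [d [[xm _] mdvd]]] := graph_gen QZ_div x g0.
have [n n1 ndvd] : exists2 n : nat, (1 < n)%N &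
    forall k : int, x *~ k = 0 -> (n %| k)%Z.
  case: m xm mdvd => [_ mdvd|[/eqP|m _ mdvd]]; last 2 first.
  - by rewrite mulr1n (negPf x0).
  - by exists m.+2 => // k xk; apply: (mdvd k 0); rewrite xk.
  exists 2%N => // k xk; have := mdvd k 0; rewrite xk dvd0z => /(_ erefl)/eqP->.
  by rewrite dvdz0.
pose c := piQZ n%:R^-1.
have gG : graph [set u | exists k : int, u = (x *~ k, c *~ k)].
  split=> [|u v [k ->] [l ->]|e [k [/esym/ndvd/dvdzP[q ->] ->]]].
  - by exists 0; rewrite !mulr0z.
  - by exists (k - l); rewrite !mulrzBr.
  - apply/eqP; rewrite -raddfMz piQZ_eq0 -mulrzr intrM mulrCA.
    rewrite mulVf ?mulr1 ?intr_int//.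
    by rewrite pnatr_eq0 -lt0n ltnW.
have [chi chiP] := additive_extension QZ_div gG.
exists chi; rewrite (chiP x c); last by exists 1; rewrite !mulr1z.
rewrite piQZ_eq0; apply/negP => /intrP[z zE].
have z0 : 0 < (z%:~R : rat) by rewrite -zE invr_gt0 ltr0n ltnW.
have z1 : (z%:~R : rat) < 1 by rewrite -zE invf_lt1 ?ltr1n// ltr0n ltnW.
rewrite ltr0z in z0; rewrite (ltrz1 rat) in z1.
by move: (lt_le_trans z1 z0); rewrite ltxx.
Qed.

Variables (R : comNzRingType) (D : zmodType).

Definition is_additive : {pred R -> D} :=
  [pred f : R -> D | `[< zmod_morphism f >]].
Lemma is_additive_zmod : zmod_closed is_additive.
Proof.
split=> [|f g /asboolP fA /asboolP gA]; apply/asboolP => x y /=.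
  by rewrite subrr.
by rewrite !fctE /= fA gA !opprD addrACA.
Qed.
HB.instance Definition _ :=
  GRing.isZmodClosed.Build (R -> D) is_additive is_additive_zmod.

(* Hom_Z(R, D) *)
Definition coind := {f : R -> D | f \in is_additive}.
HB.instance Definition _ := SubChoice.on coind.
HB.instance Definition _ := GRing.SubChoice_isSubZmodule.Build (R -> D)
  is_additive coind is_additive_zmod.

Lemma coindP (f : coind) : zmod_morphism (val f).
Proof. exact/asboolP/(valP f). Qed.

(* (a f)(s) = f(sa) *)
Lemma coind_scale_subproof (a : R) (f : coind) :
  (fun s => val f (s * a)) \in is_additive.
Proof. by apply/asboolP => x y; rewrite mulrBl coindP. Qed.
Definition coind_scale a f : coind :=
  Sub (fun s => val f (s * a)) (coind_scale_subproof a f).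

Lemma coind_scaleA a b v :
  coind_scale a (coind_scale b v) = coind_scale (a * b) v.
Proof. by apply: val_inj; apply/funext => s /=; rewrite mulrA. Qed.
Lemma coind_scale1 : left_id 1 coind_scale.
Proof. by move=> f; apply: val_inj; apply/funext => s /=; rewrite mulr1. Qed.
Lemma coind_scaleDr : right_distributive coind_scale +%R.
Proof. by move=> a f g; apply: val_inj; apply/funext => s. Qed.
Lemma coind_additive (f : coind) x y : val f (x + y) = val f x + val f y.
Proof.
pose F : {additive R -> D} :=
  HB.pack (val f) (GRing.isZmodMorphism.Build R D (val f) (coindP f)).
exact: (raddfD F).
Qed.
Lemma coind_scaleDl f : {morph coind_scale^~ f : a b / a + b}.
Proof.
move=> a b; apply: val_inj; apply/funext => s /=.
by rewrite mulrDr coind_additive.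
Qed.
HB.instance Definition _ := GRing.Zmodule_isLmodule.Build R coind
  coind_scaleA coind_scale1 coind_scaleDr coind_scaleDl.

Lemma coind_injective :
  (forall (d : D) (n : nat), (0 < n)%N -> exists e, e *+ n = d) ->
  injective_module coind.
Proof.
move=> divD A B f g finj.
have gG : graph [set u | exists a, u = (f a, val (g a) 1)].
  split=> [|u v [a ->] [b ->]|d [a [/esym fa ->]]].
  - by exists 0; rewrite !linear0.
  - by exists (a - b); rewrite !linearB.
  - have -> : a = 0 by apply: finj; rewrite fa linear0.
    by rewrite linear0.
have [h hP] := additive_extension divD gG.
have hA b : (fun r : R => h (r *: b)) \in is_additive.
  by apply/asboolP => x y; rewrite scalerBl raddfB.
pose H b : coind := Sub (fun r : R => h (r *: b)) (hA b).
have HL : linear H.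
  move=> a x y; apply: val_inj; apply/funext => s /=.
  by rewrite scalerDr raddfD scalerA.
exists (mkLin HL) => a; apply: val_inj; apply/funext => r /=.
have := hP (f (r *: a)) (val (g (r *: a)) 1) (ex_intro _ (r *: a) erefl).
by rewrite !linearZ /= mul1r.
Qed.

End CharacterModule.

Section CanonicalResolution.
Variable R : comNzRingType.
Implicit Types X : lmodType R.

Definition limage X (Y : lmodType R) (f : {linear X -> Y}) : {pred Y} :=
  [pred y | `[< exists x, y = f x >]].
Lemma limage_submod X (Y : lmodType R) (f : {linear X -> Y}) :
  submod_closed (limage f).
Proof.
split=> [|c x y]; first by apply/asboolP; exists 0; rewrite linear0.
move=> /asboolP[u ->] /asboolP[v ->]; apply/asboolP.
by exists (c *: u + v); rewrite linearP.
Qed.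
HB.instance Definition _ X (Y : lmodType R) (f : {linear X -> Y}) :=
  GRing.isSubmodClosed.Build R Y (limage f) (limage_submod f).

Lemma character_exists X (x : X) :
  exists chi : {additive X -> QZ}, x != 0 -> chi x != 0.
Proof.
have [->|/character_neq0[chi chiP]] := eqVneq x 0; last by exists chi.
by exists \0.
Qed.
Definition character X (x : X) : {additive X -> QZ} :=
  projT1 (cid (character_exists x)).

(* X embeds in the injective module Hom_Z(R, (Q/Z)^X). *)
Definition inj_env X : lmodType R := coind R (X -> QZ).

Lemma inj_envP X : injective_module (inj_env X).
Proof.
apply: coind_injective => d n n0.
have /choice[e eP] : forall x : X, exists e, e *+ n = d x.
  by move=> x; exact: QZ_div.
by exists e; apply/funext => x; rewrite natmulfctE.
Qed.

Lemma inj_emb_subproof X (x : X) :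
  (fun (r : R) (j : X) => character j (r *: x)) \in @is_additive R (X -> QZ).
Proof.
by apply/asboolP => r s; apply/funext => j /=; rewrite scalerBl raddfB.
Qed.
Definition inj_emb_fun X (x : X) : inj_env X :=
  Sub (fun (r : R) (j : X) => character j (r *: x)) (inj_emb_subproof x).
Lemma inj_emb_linear X : linear (@inj_emb_fun X).
Proof.
move=> a x y; apply: val_inj; apply/funext => r; apply/funext => j /=.
by rewrite scalerDr raddfD scalerA.
Qed.
Definition inj_emb X : {linear X -> inj_env X} := mkLin (@inj_emb_linear X).

Lemma inj_emb_inj X : injective (inj_emb X).
Proof.
apply: raddf_inj => x x0; apply/eqP; apply: contraT => xn0.
have := projT2 (cid (character_exists x)) xn0.
have := congr1 (fun f => val f (1 : R) x) x0.
by rewrite /= scale1r /character => ->; rewrite eqxx.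
Qed.

Fixpoint cosyzygy X (i : nat) : lmodType R :=
  if i is j.+1 then quotm (limage (inj_emb (cosyzygy X j))) else X.

Definition can_diff X i :
    {linear inj_env (cosyzygy X i) -> inj_env (cosyzygy X i.+1)} :=
  inj_emb (cosyzygy X i.+1) \o proj (limage (inj_emb (cosyzygy X i))).

Lemma can_diff_eq0 X i y :
  can_diff X i y = 0 <-> exists x, y = inj_emb (cosyzygy X i) x.
Proof.
rewrite -(linear0 (inj_emb (cosyzygy X i.+1))); split.
  by move=> /inj_emb_inj/eqP; rewrite proj_eq0 => /asboolP.
move=> xP; congr (inj_emb _ _); apply/eqP; rewrite proj_eq0.
exact/asboolP.
Qed.

Lemma can_diffP X i y : can_diff X i.+1 y = 0 <-> exists x, y = can_diff X i x.
Proof.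
rewrite can_diff_eq0; split=> [[z ->]|[x ->]]; last by eexists.
by have [x <-] := proj_surj z; exists x.
Qed.

Lemma can_diffK X i x : can_diff X i.+1 (can_diff X i x) = 0.
Proof. by apply/can_diffP; exists x. Qed.

Definition can_cochain X : cochain R :=
  @Cochain R (fun i => inj_env (cosyzygy X i)) (can_diff X) (@can_diffK X).

Definition can_resolution X : injective_resolution X :=
  @InjectiveResolution R X (can_cochain X) (inj_emb X)
    (fun i => @inj_envP (cosyzygy X i)) (@inj_emb_inj X)
    (@can_diff_eq0 X 0) (@can_diffP X).

End CanonicalResolution.

Section Ext.
Variable R : comNzRingType.
Implicit Types M N X : lmodType R.

(* Ext^i(N, X) = H^i(Hom(N, I)) for an injective resolution I of X; up to
   isomorphism it does not depend on I. *)
Definition Ext (i : nat) N X : lmodType R :=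
  cohomology (hom_cochain N (can_resolution X)) i.

Definition Ext_map (i : nat) N N' (h : {linear N' -> N}) X :
    {linear Ext i N X -> Ext i N' X} :=
  cohomology_map (hom_precomp h (can_resolution X)) i.

End Ext.

Section DirectLimit.
Variables (R : pzRingType) (D : nat -> lmodType R).

Definition seqprod := forall k, D k.
HB.instance Definition _ := gen_eqMixin seqprod.
HB.instance Definition _ := gen_choiceMixin seqprod.

Implicit Types s t u : seqprod.
Definition seqadd s t : seqprod := fun k => s k + t k.
Definition seqopp s : seqprod := fun k => - s k.
Definition seqscale (a : R) s : seqprod := fun k => a *: s k.

Lemma seqaddA : associative seqadd.
Proof.
by move=> s t u; apply: functional_extensionality_dep => k; exact: addrA.
Qed.
Lemma seqaddC : commutative seqadd.
Proof.
by move=> s t; apply: functional_extensionality_dep => k; exact: addrC.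
Qed.
Lemma seqadd0 : left_id (fun k => 0) seqadd.
Proof.
by move=> s; apply: functional_extensionality_dep => k; exact: add0r.
Qed.
Lemma seqaddN : left_inverse (fun k => 0) seqopp seqadd.
Proof.
by move=> s; apply: functional_extensionality_dep => k; exact: addNr.
Qed.
HB.instance Definition _ :=
  GRing.isZmodule.Build seqprod seqaddA seqaddC seqadd0 seqaddN.

Lemma seqscaleA a b s : seqscale a (seqscale b s) = seqscale (a * b) s.
Proof. by apply: functional_extensionality_dep => k; exact: scalerA. Qed.
Lemma seqscale1 : left_id 1 seqscale.
Proof.
by move=> s; apply: functional_extensionality_dep => k; exact: scale1r.
Qed.
Lemma seqscaleDr : right_distributive seqscale +%R.
Proof.
by move=> a s t; apply: functional_extensionality_dep => k; exact: scalerDr.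
Qed.
Lemma seqscaleDl s : {morph seqscale^~ s : a b / a + b}.
Proof.
by move=> a b; apply: functional_extensionality_dep => k; exact: scalerDl.
Qed.
HB.instance Definition _ := GRing.Zmodule_isLmodule.Build R seqprod
  seqscaleA seqscale1 seqscaleDr seqscaleDl.

Variable f : forall k, {linear D k -> D k.+1}.

(* The direct limit of D 0 -> D 1 -> ... is encoded as the module of sequences
   that are compatible with the transition maps from some index on, modulo the
   sequences that are 0 from some index on. [germ] gives the structure maps and
   [dirlim_univ] the universal property. *)
Definition coherent : {pred seqprod} :=
  [pred s : seqprod |
   `[< exists K, forall k, (K <= k)%N -> s k.+1 = f k (s k) >]].
Lemma coherent_submod : submod_closed coherent.
Proof.
split=> [|a s t /asboolP[K sK] /asboolP[L tL]]; apply/asboolP.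
  by exists 0%N => k _; rewrite [RHS]linear0.
exists (maxn K L) => k; rewrite geq_max => /andP[Kk Lk].
by rewrite [RHS]linearP -sK// -tL.
Qed.
HB.instance Definition _ :=
  GRing.isSubmodClosed.Build R seqprod coherent coherent_submod.

Definition ev_zero : {pred subm coherent} :=
  [pred s | `[< exists K, forall k, (K <= k)%N -> (val s : seqprod) k = 0 >]].
Lemma ev_zero_submod : submod_closed ev_zero.
Proof.
split=> [|a s t /asboolP[K sK] /asboolP[L tL]]; apply/asboolP.
  by exists 0%N.
exists (maxn K L) => k; rewrite geq_max => /andP[Kk Lk].
have : a *: (val s : seqprod) k + (val t : seqprod) k = 0.
  by rewrite sK// tL// scaler0 addr0.
exact.
Qed.
HB.instance Definition _ :=
  GRing.isSubmodClosed.Build R (subm coherent) ev_zero ev_zero_submod.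

Definition dirlim : lmodType R := quotm ev_zero.

Fixpoint push k (x : D k) (j : nat) : D j :=
  if k =P j is ReflectT e then ecast i (D i) e x
  else if j is j'.+1 then f j' (push x j') else 0.

Lemma push_id k (x : D k) : push x k = x.
Proof. by case: k x => [|k] x /=; case: eqP => // e; rewrite eq_axiomK. Qed.

Lemma push_step k (x : D k) j : (k <= j)%N -> push x j.+1 = f j (push x j).
Proof. by move=> kj /=; case: eqP => // e; exfalso; rewrite e ltnn in kj. Qed.

Lemma push_linear k j : linear (fun x : D k => push x j).
Proof.
elim: j => [|j IHj] a x y /=; case: eqP => [e|_].
- by case: _ / e.
- by rewrite scaler0 addr0.
- by case: _ / e.
- by rewrite IHj linearP.
Qed.

Lemma push_coherent k (x : D k) : (push x : seqprod) \in coherent.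
Proof. by apply/asboolP; exists k => j; exact: push_step. Qed.

Definition germ_fun k (x : D k) : dirlim :=
  proj ev_zero (Sub (push x : seqprod) (push_coherent x)).
Lemma germ_linear k : linear (@germ_fun k).
Proof.
move=> a x y; rewrite -linearP; congr (proj _ _); apply: val_inj => /=.
by apply: functional_extensionality_dep => j; exact: push_linear.
Qed.
Definition germ k : {linear D k -> dirlim} := mkLin (@germ_linear k).

Lemma germ_eq0 k (x : D k) :
  germ k x = 0 <-> exists2 j, (k <= j)%N & push x j = 0.
Proof.
split=> [/eqP|[j kj xj]].
  rewrite proj_eq0 => /asboolP[K xK]; exists (maxn k K); rewrite ?leq_maxl//.
  by apply: xK; rewrite leq_maxr.
apply/eqP; rewrite proj_eq0; apply/asboolP; exists j => /= i.
elim: i => [|i IHi]; first by rewrite leqn0 => /eqP <-.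
rewrite leq_eqVlt => /predU1P[<-//|]; rewrite ltnS => ji.
by rewrite push_step ?IHi ?linear0// (leq_trans kj).
Qed.

Lemma germ_step k (x : D k) : germ k.+1 (f k x) = germ k x.
Proof.
apply/eqP; rewrite -subr_eq0 /= /germ_fun -linearB proj_eq0.
apply/asboolP; exists k.+1 => j.
suff : (k < j)%N -> push (f k x) j - push x j = 0 by [].
elim: j => [//|j IHj]; rewrite leq_eqVlt => /predU1P[<-|].
  by rewrite (push_step x)// !push_id subrr.
by rewrite ltnS => kj; rewrite !push_step ?(ltnW kj)// -linearB IHj ?linear0.
Qed.

Lemma germ_surj (z : dirlim) : exists k x, z = germ k x.
Proof.
have [s <-] := proj_surj z; have /asboolP[K sK] := valP s.
exists K, ((val s : seqprod) K); apply/eqP.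
rewrite -subr_eq0 /= /germ_fun -linearB proj_eq0.
apply/asboolP; exists K => j.
suff : (K <= j)%N ->
  (val s : seqprod) j - push ((val s : seqprod) K) j = 0 by [].
elim: j => [|j IHj]; first by rewrite leqn0 => /eqP<-; rewrite push_id subrr.
rewrite leq_eqVlt => /predU1P[<-|]; first by rewrite push_id subrr.
by rewrite ltnS => Kj; rewrite push_step// sK// -linearB IHj// linear0.
Qed.

Lemma germ_push k (x : D k) j : (k <= j)%N -> germ j (push x j) = germ k x.
Proof.
elim: j => [|j IHj].
  by rewrite leqn0 => /eqP e; case: _ / e x => x; rewrite push_id.
rewrite leq_eqVlt => /predU1P[e|]; first by case: _ / e; rewrite push_id.
by rewrite ltnS => kj; rewrite push_step// germ_step IHj.
Qed.

Lemma dirlim_univ (L : lmodType R) (g : forall k, {linear D k -> L}) :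
  (forall k x, g k.+1 (f k x) = g k x) ->
  exists! h : dirlim -> L, linear h /\ forall k x, h (germ k x) = g k x.
Proof.
move=> gf.
have g_push k (x : D k) j : (k <= j)%N -> g j (push x j) = g k x.
  elim: j => [|j IHj].
    by rewrite leqn0 => /eqP e; case: _ / e x => x; rewrite push_id.
  rewrite leq_eqVlt => /predU1P[e|]; first by case: _ / e; rewrite push_id.
  by rewrite ltnS => kj; rewrite push_step// gf IHj.
have /choice[h hP] : forall z : dirlim, exists y : L, exists k x,
    z = germ k x /\ y = g k x.
  by move=> z; have [k [x ->]] := germ_surj z; exists (g k x), k, x.
have hE k x : h (germ k x) = g k x.
  have [l [y [xy ->]]] := hP (germ k x).
  pose m := maxn k l; have [km lm] : (k <= m)%N /\ (l <= m)%N.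
    by rewrite leq_maxl leq_maxr.
  rewrite -(g_push _ _ _ km) -(g_push _ _ _ lm).
  have /germ_eq0[j mj pj] : germ m (push y m - push x m) = 0.
    by rewrite linearB !germ_push// xy subrr.
  by apply/eqP; rewrite -subr_eq0 -linearB -(g_push _ _ _ mj) pj linear0.
exists h; split.
  split=> // a z w; have [k [x ->]] := germ_surj z.
  have [l [y ->]] := germ_surj w.
  pose m := maxn k l; have [km lm] : (k <= m)%N /\ (l <= m)%N.
    by rewrite leq_maxl leq_maxr.
  by rewrite -(germ_push _ km) -(germ_push _ lm) -linearP !hE linearP.
move=> h' [_ h'E]; apply/funext => z; have [k [x ->]] := germ_surj z.
by rewrite hE h'E.
Qed.

End DirectLimit.

(* [set (prime_idealr R)] is a universe inconsistency, because the library
   declares that record over [pred R]. *)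
Record Spec (R : comNzRingType) := PrimeIdeal {
  spec_pred :> R -> bool;
  spec_idealr : idealr_closed spec_pred;
  spec_prime : prime_idealr_closed spec_pred }.

HB.instance Definition _ (R : comNzRingType) (p : Spec R) :=
  isIdealr.Build R (spec_pred p) (spec_idealr p).
HB.instance Definition _ (R : comNzRingType) (p : Spec R) :=
  isPrimeIdealrClosed.Build R (spec_pred p) (spec_prime (s := p)).

Section Localization.
Variables (R : comNzRingType) (p : Spec R) (V : lmodType R).

Definition denom := {s : R | s \notin (p : pred R)}.
Definition den (s : denom) : R := sval s.
Implicit Types (x y : V * denom) (s t : denom).

Lemma denom1_subproof : 1 \notin (p : pred R).
Proof. by rewrite idealr1. Qed.
Definition denom1 : denom := exist _ 1 denom1_subproof.

Lemma denomM_subproof s t : den s * den t \notin (p : pred R).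
Proof. by rewrite prime_idealrM negb_or (valP s) (valP t). Qed.
Definition denomM s t : denom := exist _ (den s * den t) (denomM_subproof s t).

Lemma den1 : den denom1 = 1. Proof. by []. Qed.
Lemma denM s t : den (denomM s t) = den s * den t. Proof. by []. Qed.

Definition frac_equiv x y : bool :=
  `[< exists u : denom,
      (den u * den y.2) *: x.1 = (den u * den x.2) *: y.1 >].

Lemma frac_equiv_is_equiv : equiv_class_of frac_equiv.
Proof.
split=> [x|x y|y x z]; first by apply/asboolP; exists denom1.
  by apply/asboolP/asboolP => -[u e]; exists u.
move=> /asboolP[u e] /asboolP[v e']; apply/asboolP.
exists (denomM (denomM u v) y.2); rewrite /= ?denM ?den1.
rewrite (_ : _ * den z.2 = (den v * den z.2) * (den u * den y.2)); last by ring.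
rewrite -[LHS]scalerA e scalerA.
rewrite [den v * _ * _]mulrC.
by rewrite -[LHS]scalerA e' scalerA; congr (_ *: _); ring.
Qed.
Canonical frac_equiv_rel := EquivRelPack frac_equiv_is_equiv.
Canonical frac_encModRel := defaultEncModRel frac_equiv.

Definition localization := {eq_quot frac_equiv}.
HB.instance Definition _ := Choice.on localization.
HB.instance Definition _ := EqQuotient.on localization.

Definition frac (v : V) (s : denom) : localization := \pi_localization (v, s).

Lemma fracP (z : localization) : exists v s, z = frac v s.
Proof.
by exists (repr z).1, (repr z).2; rewrite /frac -surjective_pairing reprK.
Qed.

Lemma frac_eq v s w t : frac v s = frac w t <->
  exists u : denom, (den u * den t) *: v = (den u * den s) *: w.
Proof.
rewrite /frac; split=> [/eqP|uE]; last apply/eqP.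
  by rewrite -[_ == _]/(_ == _ %[mod localization]) piE => /asboolP.
by rewrite -[_ == _]/(_ == _ %[mod localization]) piE; apply/asboolP.
Qed.

Definition loc_add (z w : localization) : localization :=
  frac (den (repr w).2 *: (repr z).1 + den (repr z).2 *: (repr w).1)
       (denomM (repr z).2 (repr w).2).
Definition loc_opp (z : localization) : localization :=
  frac (- (repr z).1) (repr z).2.
Definition loc_scale (a : R) (z : localization) : localization :=
  frac (a *: (repr z).1) (repr z).2.

Lemma frac_repr v s : exists u : denom,
  (den u * den s) *: (repr (frac v s)).1 =
  (den u * den (repr (frac v s)).2) *: v.
Proof. by apply/frac_eq; rewrite /frac -surjective_pairing reprK. Qed.

Lemma loc_addE v s w t : loc_add (frac v s) (frac w t) =
  frac (den t *: v + den s *: w) (denomM s t).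
Proof.
have [u uE] := frac_repr v s; have [u' uE'] := frac_repr w t.
apply/frac_eq; exists (denomM u u'); rewrite /= ?denM ?den1.
move: (repr (frac v s)) (repr (frac w t)) uE uE' => [v' s'] [w' t'] /= uE uE'.
rewrite !scalerDr !scalerA; congr (_ + _).
  rewrite (_ : _ * den t' = (den u' * den t * den t') * (den u * den s));
    last by ring.
  by rewrite -[LHS]scalerA uE scalerA; congr (_ *: _); ring.
rewrite (_ : _ * den s' = (den u * den s * den s') * (den u' * den t));
  last by ring.
by rewrite -[LHS]scalerA uE' scalerA; congr (_ *: _); ring.
Qed.

Lemma loc_oppE v s : loc_opp (frac v s) = frac (- v) s.
Proof.
have [u uE] := frac_repr v s; apply/frac_eq; exists u.
by rewrite !scalerN uE.
Qed.

Lemma loc_scaleE a v s : loc_scale a (frac v s) = frac (a *: v) s.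
Proof.
have [u uE] := frac_repr v s; apply/frac_eq; exists u.
by rewrite !scalerA ![_ * a]mulrC -![(a * _) *: _]scalerA uE.
Qed.

Lemma frac_scale v s t : frac (den t *: v) (denomM s t) = frac v s.
Proof.
by apply/frac_eq; exists denom1; rewrite denM den1 scalerA !mul1r.
Qed.

Lemma loc_addA : associative loc_add.
Proof.
move=> x y z; have [u [r ->]] := fracP x; have [v [s ->]] := fracP y.
have [w [t ->]] := fracP z; rewrite !loc_addE.
apply/frac_eq; exists denom1; rewrite /= ?denM ?den1.
rewrite !scalerDr !scalerA !addrA.
by congr (_ *: _ + _ *: _ + _ *: _); ring.
Qed.
Lemma loc_addC : commutative loc_add.
Proof.
move=> x y; have [u [r ->]] := fracP x; have [v [s ->]] := fracP y.
rewrite !loc_addE.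
apply/frac_eq; exists denom1; rewrite /= ?denM ?den1.
by rewrite !scalerDr !scalerA addrC; congr (_ *: _ + _ *: _); ring.
Qed.
Lemma loc_add0 : left_id (frac 0 denom1) loc_add.
Proof.
move=> x; have [u [r ->]] := fracP x; rewrite loc_addE; apply/frac_eq.
exists denom1; rewrite /= ?denM ?den1.
by rewrite !scaler0 add0r !scalerA; congr (_ *: _); ring.
Qed.
Lemma loc_addN : left_inverse (frac 0 denom1) loc_opp loc_add.
Proof.
move=> x; have [u [r ->]] := fracP x; rewrite loc_oppE loc_addE; apply/frac_eq.
by exists denom1; rewrite scalerN addNr !scaler0.
Qed.
HB.instance Definition _ :=
  GRing.isZmodule.Build localization loc_addA loc_addC loc_add0 loc_addN.

Lemma loc_scaleA a b z : loc_scale a (loc_scale b z) = loc_scale (a * b) z.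
Proof. by have [v [s ->]] := fracP z; rewrite !loc_scaleE scalerA. Qed.
Lemma loc_scale1 : left_id 1 loc_scale.
Proof. by move=> z; have [v [s ->]] := fracP z; rewrite loc_scaleE scale1r. Qed.
Lemma loc_scaleDr : right_distributive loc_scale +%R.
Proof.
move=> a x y; have [u [r ->]] := fracP x; have [v [s ->]] := fracP y.
rewrite [LHS](congr1 (loc_scale a) (loc_addE _ _ _ _)) !loc_scaleE.
rewrite [RHS]loc_addE scalerDr; congr frac.
by rewrite !scalerA ![a * _]mulrC.
Qed.
Lemma loc_scaleDl z : {morph loc_scale^~ z : a b / a + b}.
Proof.
move=> a b; have [v [s ->]] := fracP z; rewrite !loc_scaleE [RHS]loc_addE.
by rewrite -scalerDr frac_scale -scalerDl.
Qed.
HB.instance Definition _ := GRing.Zmodule_isLmodule.Build R localization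
  loc_scaleA loc_scale1 loc_scaleDr loc_scaleDl.

Lemma frac0 v s :
  frac v s = 0 <-> exists2 u : R, u \notin (p : pred R) & u *: v = 0.
Proof.
rewrite [0]/(frac 0 denom1); split=> [/frac_eq[u /=]|[u up uv]].
  by rewrite mulr1 scaler0 => uv; exists (den u); [exact: (valP u)|].
apply/frac_eq; exists (exist _ u up : denom); rewrite /= ?denM ?den1.
by rewrite mulr1 scaler0.
Qed.

End Localization.

Section LocalCohomology.
Variable R : comNzRingType.
Implicit Types (a b : ideal R) (M X V : lmodType R).

Definition nonzero V : Prop := exists x : V, x != 0.

Definition Supp V : set (Spec R) :=
  [set p : Spec R | nonzero (localization p V)].

Definition zariski_closed (Z : set (Spec R)) : Prop :=
  exists b, Z = [set p : Spec R | forall r : R, r \in b -> r \in (p : pred R)].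

Definition idealM a M : submodClosed M := mulsm a [set: M].

Lemma span_sub V (A B : set V) : A `<=` B -> {subset span A <= span B}.
Proof.
move=> AB x /asboolP[s sA ->]; apply/asboolP; exists s => // p ps.
exact/AB/sA.
Qed.

Lemma idealX_step a k : {subset idealX a k.+1 <= idealX a k}.
Proof.
elim: k => [|k IHk]; first exact: span_sub.
apply: span_sub => _ [r [y [ra yk ->]]]; exists r, y; split=> //.
exact: IHk.
Qed.

Lemma idealXM_step a k M x :
  x \in idealM (idealX a k.+1) M -> proj (idealM (idealX a k) M) x = 0.
Proof.
move=> xM; apply/eqP; rewrite proj_eq0.
apply: span_sub xM => _ [r [y [rk _ ->]]]; exists r, y; split=> //.
exact: idealX_step.
Qed.

(* M / a^(k+1) M -> M / a^k M *)
Definition power_proj a M k : {linear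
    quotm (idealM (idealX a k.+1) M) -> quotm (idealM (idealX a k) M)} :=
  qlift (@idealXM_step a k M).

Definition gen_loc_coh (i : nat) a M X : lmodType R :=
  dirlim (D := fun k => Ext i (quotm (idealM (idealX a k) M)) X)
    (fun k => Ext_map i (power_proj a M k) X).

Definition loc_coh (i : nat) a X : lmodType R := gen_loc_coh i a R^o X.

(* The supremum of the degrees of nonzero local cohomology is taken in the
   extended integers, so that cd is -oo when all these modules vanish;
   [cd_largest]: it is the largest such degree when there is one. *)
Definition cd a X : \bar int :=
  supremum -oo%E [set i%:Z%:E | i in [set i | nonzero (loc_coh i a X)]].

Lemma cd_largest a X c : nonzero (loc_coh c a X) ->
  (forall i, nonzero (loc_coh i a X) -> (i <= c)%N) -> cd a X = c%:Z%:E.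
Proof.
move=> c0 cmax; have ubP : ubound [set i%:Z%:E | i in
    [set i | nonzero (loc_coh i a X)]] (c%:Z%:E : \bar int).
  by move=> _ [i /cmax ic <-]; rewrite lee_fin lez_nat.
rewrite /cd /supremum; case: eqP => [e|_].
  by suff : set0 (c%:Z%:E : \bar int); [|rewrite -e; exists c].
have cS : supremums [set i%:Z%:E | i in [set i | nonzero (loc_coh i a X)]]
    (c%:Z%:E : \bar int) by split=> // y; apply; exists c.
by apply: (is_subset1_supremums (xgetPex _ _) cS); exists c%:Z%:E.
Qed.

End LocalCohomology.

(* Main.v *)
From HB Require Import structures.
From mathcomp Require Import all_boot all_order all_algebra.
From mathcomp Require Import all_classical constructive_ereal.
From mathcomp Require Import ring.
Require Import Defs.

(** Fix a prime p. All the statements compare the vanishing at p, for i <=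
    n, of the modules H^i_a(M, X), Ext^i(M / a M, X) and H^i_b(X), where b =
    a + Ann M.

    The key fact is that, for finitely generated N, the vanishing at p of
    Ext^i(N, X) for all i <= n depends only on the support of N
    ([Ext_zero_support]). It is proved by devissage to modules R / q, using
    a nonzero homomorphism N -> R / q ([nonzero_hom_to_prime]) and the long
    exact sequence of Ext in the first variable. By Nakayama's lemma the
    modules M / a^k M with k >= 1, M / a M and R / b all have the support
    V(b). Thus, if Ext^i(M / a M, X) vanishes at p for i <= n, then every
    stage of the direct system that defines H^i_a(M, X) vanishes at p. For
    the converse, in the first degree where Ext^i(M / a M, X) does not
    vanish at p, the transition maps are injective at p, because their
    kernels are controlled by Ext^(i-1) of modules with support in V(b); so
    the limit does not vanish at p either ([gen_loc_coh_zeroP]). This gives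
    (b), and (a) follows by applying it to the pair (b, R) as well.

    For X finitely generated the modules Ext^i(M / a M, X) are finitely
    generated ([Ext_fin_gen]), so their supports are closed and (b) implies
    (c). For (d), the union over all degrees is the closed set V(b + Ann X):
    if p lies in V(b) and all Ext^i(M / a M, X) vanish at p, then Nakayama's
    lemma and devissage show that all Ext^i(V, X) with V finitely generated
    vanish at p, in particular Hom(R, X) = X ([Ext_zero_all]).

    Finally, a prime in the support of H^n_a(M, X) lies by (a) in the
    support of some H^i_b(X), where i is at most the cohomological
    dimension, and by (a) again in the support of some H^j_a(M, X) with j <=
    i. *)

Set Implicit Arguments.
Unset Strict Implicit.
Unset Printing Implicit Defensive.

Import Order.TTheory GRing.Theory Num.Theory.

Local Open Scope classical_set_scope.
Local Open Scope ring_scope.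

(** * Submodules and finite generation *)

Definition contained (R : comNzRingType) (b : ideal R) (q : Spec R) :=
  forall r : R, r \in b -> r \in (q : pred R).

Section Submodules.
Variable R : comNzRingType.
Implicit Types V W : lmodType R.

Lemma submod_pred_closed V (P : V -> Prop) : P 0 ->
  (forall c x y, P x -> P y -> P (c *: x + y)) ->
  submod_closed [pred x : V | `[< P x >]].
Proof.
move=> P0 PD; split=> [|c x y /asboolP Px /asboolP Py]; first exact/asboolP.
exact/asboolP/PD.
Qed.

Definition submod_of V (P : V -> Prop) (P0 : P 0)
    (PD : forall c x y, P x -> P y -> P (c *: x + y)) : submodClosed V :=
  HB.pack ([pred x : V | `[< P x >]] : {pred V})
    (GRing.isSubmodClosed.Build R V _ (submod_pred_closed P0 PD)).

Lemma submod_ofP V (P : V -> Prop) P0 PD x :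
  x \in submod_of (P := P) P0 PD <-> P x.
Proof. by split=> [/asboolP|Px]; [|exact/asboolP]. Qed.

Lemma submodB V (S : submodClosed V) x y : x \in S -> y \in S -> x - y \in S.
Proof.
by move=> xS yS; rewrite -scaleN1r; apply: rpredD => //; exact: rpredZ.
Qed.

Lemma span_gen V (A : set V) x : A x -> x \in span A.
Proof.
move=> Ax; apply/asboolP; exists [:: (1, x)].
  by move=> p; rewrite inE => /eqP ->.
by rewrite big_seq1 scale1r.
Qed.

Lemma span_min V (A : set V) (S : submodClosed V) :
  (forall x, A x -> x \in S) -> forall x, x \in span A -> x \in S.
Proof.
move=> AS x /asboolP[s sA ->]; rewrite big_seq; apply: rpred_sum => p ps.
by apply: rpredZ; exact/AS/sA.
Qed.

Lemma span_cons V x (l : seq V) y :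
  y \in span [set` x :: l] <-> exists r : R, y - r *: x \in span [set` l].
Proof.
split=> [|[r yl]]; last first.
  rewrite -(subrK (r *: x) y); apply: rpredD.
    by apply: span_sub yl => z zl; rewrite /= inE zl orbT.
  by apply: rpredZ; apply: span_gen; rewrite /= inE eqxx.
pose P (y : V) := exists r : R, y - r *: x \in span [set` l].
have P0 : P 0 by exists 0; rewrite scale0r subr0 rpred0.
have PD c u v : P u -> P v -> P (c *: u + v).
  move=> [r ru] [s sv]; exists (c * r + s).
  rewrite scalerDl opprD addrACA -scalerA -scalerBr.
  by apply: rpredD => //; exact: rpredZ.
move=> yl; apply/(submod_ofP P0 PD); move: y yl; apply: span_min => y.
rewrite /= inE => /predU1P[->|yl]; apply/(submod_ofP P0 PD).
  by exists 1; rewrite scale1r subrr rpred0.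
by exists 0; rewrite scale0r subr0; exact: span_gen.
Qed.

Lemma span_nil V (y : V) : y \in span [set` Nil V] <-> y = 0.
Proof.
split=> [|->]; last exact: rpred0.
have P0 : (fun y : V => y = 0) 0 by [].
have PD c (u v : V) : u = 0 -> v = 0 -> c *: u + v = 0.
  by move=> -> ->; rewrite scaler0 addr0.
by move=> yl; apply/(submod_ofP P0 PD); move: y yl; exact: span_min.
Qed.

Lemma span_map V W (f : {linear V -> W}) (l : seq V) x :
  x \in span [set` l] -> f x \in span [set` map f l].
Proof.
elim: l x => [|y l IHl] x; first by move/span_nil->; rewrite linear0 rpred0.
move=> /span_cons[r /IHl xl]; apply/span_cons; exists r.
by rewrite -linearZ -linearB.
Qed.

Lemma fin_gen_surj V W (f : {linear V -> W}) :
  (forall w, exists v, f v = w) -> fin_gen V -> fin_gen W.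
Proof.
move=> fs [l lV]; exists (map f l) => w; have [v <-] := fs w.
exact: span_map.
Qed.

Lemma span_nth V (l : seq V) x : x \in span [set` l] <->
  exists u : 'I_(size l) -> R, x = \sum_i u i *: l`_i.
Proof.
split=> [|[u ->]]; last first.
  apply: rpred_sum => i _; apply: rpredZ; apply: span_gen.
  exact: mem_nth.
elim: l x => [|y l IHl] x.
  by move=> /span_nil ->; exists (fun=> 0); rewrite big_ord0.
move=> /span_cons[r /IHl[u xE]].
exists (fun i => if unlift ord0 i is Some j then u j else r).
rewrite big_ord_recl unlift_none /=; under eq_bigr do rewrite liftK.
by rewrite -xE addrC subrK.
Qed.

Lemma annihP V (r : R) : r \in annih V <-> forall x : V, r *: x = 0.
Proof. by split=> [/asboolP|]; [|move=> r0; exact/asboolP]. Qed.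

Lemma annih_inj V W (f : {linear V -> W}) r :
  injective f -> r \in annih W -> r \in annih V.
Proof.
move=> fi /annihP rW; apply/annihP => x.
apply: fi; rewrite linearZ linear0; exact: rW.
Qed.

Lemma annih_surj V W (f : {linear V -> W}) r :
  (forall w, exists v, f v = w) -> r \in annih V -> r \in annih W.
Proof.
move=> fs /annihP rV; apply/annihP => w; have [v <-] := fs w.
by rewrite -linearZ /= [_ *: v]rV linear0.
Qed.

Lemma lkernelD V W (f : {linear V -> W}) (c : R) (x y : V) :
  f x = 0 -> f y = 0 -> f (c *: x + y) = 0.
Proof. by move=> fx fy; rewrite linearP fx fy scaler0 addr0. Qed.

Definition lkernel V W (f : {linear V -> W}) : submodClosed V :=
  submod_of (linear0 f) (@lkernelD V W f).

Lemma lkernelP V W (f : {linear V -> W}) x : x \in lkernel f <-> f x = 0.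
Proof. exact: submod_ofP. Qed.

Lemma limageP V W (f : {linear V -> W}) y :
  y \in limage f <-> exists x, y = f x.
Proof. by split=> [/asboolP|]; [|move=> ?; exact/asboolP]. Qed.

Definition incl V (S : submodClosed V) : {linear subm S -> V} :=
  mkLin (f := fun x : subm S => val x) (linearP (val : {linear subm S -> V})).

Lemma incl_inj V (S : submodClosed V) : injective (incl S).
Proof. exact: val_inj. Qed.

Lemma inclP V (S : submodClosed V) x :
  x \in S <-> exists y, x = incl S y.
Proof. by split=> [xS|[y ->]]; [exists (Sub x xS)|exact: valP]. Qed.

Lemma proj0P V (S : submodClosed V) x : proj S x = 0 <-> x \in S.
Proof. by rewrite -proj_eq0; split=> [->//|/eqP]. Qed.

End Submodules.

(** * Noetherian rings *)

Section Noetherian.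
Variables (R : comNzRingType) (noethR : noetherian R).
Implicit Types V W : lmodType R.

Lemma ideal_fin_gen (J : ideal R) : exists2 l : seq R^o,
  {in l, forall r, r \in J} & forall r : R^o, r \in J -> r \in span [set` l].
Proof.
have [l lJ] := noethR J; exists l => [r rl|r]; last by rewrite lJ.
by rewrite lJ; exact: span_gen.
Qed.

(** Noetherian induction. A chain of counterexamples, each strictly larger
    than the one before, is impossible: the finitely many generators of its
    union all lie in a single term, which is then the last one. *)
Lemma ideal_ind (Q : ideal R -> Prop) :
  (forall J : ideal R,
    (forall J' : ideal R, {subset J <= J'} ->
       (exists2 r, r \in J' & r \notin J) -> Q J') -> Q J) ->
  forall J, Q J.
Proof.
move=> QI J0; apply: contrapT => nQ0.
pose bad := {J : ideal R | ~ Q J}.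
have /choice[nxt nxtP] : forall J : bad, exists J' : bad,
    {subset sval J <= sval J'} /\ exists2 r, r \in sval J' & r \notin sval J.
  move=> [J nQJ]; apply: contrapT => nJ; apply: (nQJ); apply: QI => J' JJ' J'J.
  by apply: contrapT => nQ'; apply: nJ; exists (exist _ J' nQ').
pose c k : ideal R := sval (iter k nxt (exist _ J0 nQ0)).
have cS k j r : (k <= j)%N -> r \in c k -> r \in c j.
  move=> /subnKC <-; elim: (j - k)%N => [|m IHm] rk; first by rewrite addn0.
  by rewrite addnS; apply: (nxtP _).1; exact: IHm.
pose P (r : R^o) := exists k, r \in c k.
have P0 : P 0 by exists 0%N; exact: rpred0.
have PD (s : R) (x y : R^o) : P x -> P y -> P (s *: x + y).
  move=> [k xk] [j yj]; exists (maxn k j); apply: rpredD.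
    by apply: rpredZ; apply: cS xk; exact: leq_maxl.
  by apply: cS yj; exact: leq_maxr.
have [l lU Ul] := ideal_fin_gen (submod_of P0 PD).
have [k lk] : exists k, {in l, forall r, r \in c k}.
  elim: l lU {Ul} => [|x l IHl] lU; first by exists 0%N.
  have [|k lk] := IHl; first by move=> r rl; apply: lU; rewrite inE rl orbT.
  have /submod_ofP[j xj] := lU x (mem_head _ _).
  exists (maxn k j) => r; rewrite inE => /predU1P[->|rl].
    by apply: cS xj; exact: leq_maxr.
  by apply: cS (lk _ rl); exact: leq_maxl.
have [r rk1 /negP[]] := (nxtP (iter k nxt (exist _ J0 nQ0))).2.
apply: (@span_min R R^o [set` l]) => //; apply: Ul; apply/(submod_ofP P0 PD).
by exists k.+1.
Qed.

(** Induction on l = x :: l'. The coefficients on x that occur in elements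
    of S form an ideal; elements of S that realise generators of this ideal,
    together with generators of the intersection of S with the span of l',
    generate S. *)
Lemma submod_span_fin_gen V (l : seq V) (S : submodClosed V) :
  (forall x, x \in S -> x \in span [set` l]) ->
  exists2 t : seq V, {in t, forall x, x \in S} &
    forall x, x \in S -> x \in span [set` t].
Proof.
elim: l S => [|x l IHl] S Sl.
  by exists [::] => // y /Sl.
pose P (r : R^o) := exists2 y, y \in S & y - (r : R) *: x \in span [set` l].
have P0 : P 0 by exists 0; rewrite ?scale0r ?subr0 rpred0.
have PD (c : R) (r s : R^o) : P r -> P s -> P (c *: r + s).
  move=> [y yS yr] [z zS zs]; exists (c *: y + z).
    by apply: rpredD => //; exact: rpredZ.
  rewrite scalerDl opprD addrACA -scalerA -scalerBr.
  by apply: rpredD => //; exact: rpredZ.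
have [m mJ Jm] := ideal_fin_gen (submod_of P0 PD).
have /choice[h hP] : forall r, exists y, r \in m ->
    y \in S /\ y - (r : R) *: x \in span [set` l].
  move=> r; case rm: (r \in m); last by exists 0.
  by have /submod_ofP[y yS yr] := mJ _ rm; exists y.
pose P' (y : V) := y \in S /\ y \in span [set` l].
have P'0 : P' 0 by split; exact: rpred0.
have P'D (c : R) u v : P' u -> P' v -> P' (c *: u + v).
  by move=> [uS ul] [vS vl]; split; apply: rpredD => //; exact: rpredZ.
have [|t tS St] := IHl (submod_of P'0 P'D); first by move=> y /submod_ofP[].
exists (map h m ++ t) => [y|z zS].
  rewrite mem_cat => /orP[/mapP[r rm ->]|/tS/submod_ofP[]//].
  by have [] := hP _ rm.
have /span_cons[r zr] := Sl _ zS.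
have rm : r \in span [set` m] by apply: Jm; apply/(submod_ofP P0 PD); exists z.
have [w wm [wS wr]] : exists2 w, w \in span [set` map h m] &
    w \in S /\ w - r *: x \in span [set` l].
  move/asboolP: rm => [s sm ->].
  exists (\sum_(p <- s) p.1 *: h p.2).
    rewrite big_seq; apply: rpred_sum => p ps; apply: rpredZ; apply: span_gen.
    by apply/mapP; exists p.2 => //; exact: sm.
  split; first rewrite big_seq; last rewrite scaler_suml -sumrB big_seq.
    by apply: rpred_sum => p ps; apply: rpredZ; case: (hP _ (sm _ ps)).
  apply: rpred_sum => p ps; rewrite -scalerA -scalerBr; apply: rpredZ.
  by case: (hP _ (sm _ ps)).
rewrite -(subrK w z); apply: rpredD.
  apply: (span_sub (A := [set` t])) => [y /= yt|].
    by rewrite mem_cat yt orbT.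
  apply: St; apply/(submod_ofP P'0 P'D); split; first exact: submodB.
  rewrite (_ : z - w = (z - r *: x) - (w - r *: x)); first exact: submodB.
  by rewrite opprB addrA subrK.
by apply: span_sub wm => y /= yt; rewrite mem_cat yt.
Qed.

Lemma fin_gen_inj V W (f : {linear V -> W}) :
  injective f -> fin_gen W -> fin_gen V.
Proof.
move=> fi [l lW].
have [|t tS St] := @submod_span_fin_gen W l (limage f) => //.
have /choice[h hP] : forall w, exists v, w \in t -> w = f v.
  move=> w; case wt: (w \in t); last by exists 0.
  by have /limageP[v ->] := tS _ wt; exists v.
exists (map h t) => x.
have /asboolP[s st fx] : f x \in span [set` t].
  by apply: St; apply/limageP; exists x.
have -> : x = \sum_(p <- s) p.1 *: h p.2.
  apply: fi; rewrite fx linear_sum big_seq [RHS]big_seq; apply: eq_bigr => p ps.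
  by rewrite linearZ -hP//; exact: st.
rewrite big_seq; apply: rpred_sum => p ps; apply: rpredZ; apply: span_gen.
by apply/mapP; exists p.2 => //; exact: st.
Qed.

Lemma fin_gen_subm V (S : submodClosed V) : fin_gen V -> fin_gen (subm S).
Proof. exact: fin_gen_inj (@incl_inj R V S). Qed.

Lemma fin_gen_quotm V (S : submodClosed V) : fin_gen V -> fin_gen (quotm S).
Proof. exact: fin_gen_surj (@proj_surj R V S). Qed.

Lemma fin_gen_regular : fin_gen R^o.
Proof.
exists [:: 1] => x; apply/span_cons; exists x.
by rewrite /GRing.scale /= mulr1 subrr rpred0.
Qed.

End Noetherian.

(** * Devissage of finitely generated modules *)

Section Devissage.
Variables (R : comNzRingType) (noethR : noetherian R).
Implicit Types (V W N C : lmodType R) (q : Spec R).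

Definition generates V (c : V) := forall y : V, exists r : R, y = r *: c.

Lemma generates_surj V W (f : {linear V -> W}) c :
  (forall w, exists v, f v = w) -> generates c -> generates (f c).
Proof.
move=> fs cV w; have [v <-] := fs w; have [r ->] := cV v.
by exists r; rewrite linearZ.
Qed.

Lemma generates_fin_gen V (c : V) : generates c -> fin_gen V.
Proof.
move=> cV; exists [:: c] => y; have [r ->] := cV y.
by apply/span_cons; exists r; rewrite subrr rpred0.
Qed.

Lemma annih_eltD V (c : V) (a : R) (r s : R^o) :
  (r : R) *: c = 0 -> (s : R) *: c = 0 -> (a *: r + s : R) *: c = 0.
Proof. by move=> rc sc; rewrite scalerDl sc addr0 -scalerA rc scaler0. Qed.

Definition annih_elt V (c : V) : ideal R :=
  submod_of (P := fun r : R^o => (r : R) *: c = 0) (scale0r c)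
    (@annih_eltD V c).

Lemma annih_eltP V (c : V) (r : R) : r \in annih_elt c <-> r *: c = 0.
Proof. exact: (@submod_ofP R R^o). Qed.

Lemma multiples0 V (c : V) : exists r : R, 0 = r *: c.
Proof. by exists 0; rewrite scale0r. Qed.

Lemma multiplesD V (c : V) (a : R) (x y : V) :
  (exists r : R, x = r *: c) -> (exists r : R, y = r *: c) ->
  exists r : R, a *: x + y = r *: c.
Proof.
by move=> [r ->] [s ->]; exists (a * r + s); rewrite scalerDl scalerA.
Qed.

Definition multiples V (c : V) : submodClosed V :=
  submod_of (multiples0 c) (@multiplesD V c).

Lemma multiplesP V (c v : V) : v \in multiples c <-> exists r : R, v = r *: c.
Proof. exact: submod_ofP. Qed.

Lemma multiples_cyclic V (c : V) :
  exists2 c' : subm (multiples c), generates c' & val c' = c.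
Proof.
have cc : c \in multiples c by apply/multiplesP; exists 1; rewrite scale1r.
exists (Sub c cc); last exact: SubK.
move=> y; have /multiplesP[r yr] := valP y.
by exists r; apply: val_inj; rewrite linearZ.
Qed.

Section Principle.
Variable Q : lmodType R -> Prop.
Hypothesis Q0 : forall V, (forall x : V, x = 0) -> Q V.
Hypothesis QE : forall V (S : submodClosed V),
  Q (subm S) -> Q (quotm S) -> Q V.
Hypothesis Qprime : forall q V (c : V), generates c ->
  (forall r : R, r \in (q : pred R) <-> r *: c = 0) ->
  (forall V' (c' : V'), generates c' ->
     (forall r : R, r \in (q : pred R) -> r *: c' = 0) ->
     (exists2 r : R, r \notin (q : pred R) & r *: c' = 0) -> Q V') ->
  Q V.

(** Noetherian induction on the annihilator of the generator c. If x y kills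
    c but neither x nor y does, the generators x c of the submodule and c of
    the quotient have strictly larger annihilators, containing y and x
    respectively. If there are no such x and y, the annihilator is prime. *)
Lemma devissage_cyclic V (c : V) : generates c -> Q V.
Proof.
move: {2}(annih_elt c) (erefl (annih_elt c)) => J; move: J V c.
apply: (ideal_ind noethR) => J IHJ V c JE cV; rewrite -{}JE in IHJ.
have {}IHJ V' (c' : V') : generates c' ->
    (forall r : R, r *: c = 0 -> r *: c' = 0) ->
    (exists2 r : R, r *: c' = 0 & r *: c <> 0) -> Q V'.
  move=> c'V' cc' [r rc' rc]; apply: (IHJ (annih_elt c') _ _ V' c') => //.
    by move=> s /annih_eltP /cc' sc'; apply/annih_eltP.
  exists r; first exact/annih_eltP.
  by apply/negP => /annih_eltP.
have [c0|c0] := eqVneq c 0.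
  by apply: Q0 => y; have [r ->] := cV y; rewrite c0 scaler0.
have [[x [y [xy x0 y0]]]|nxy] := pselect (exists x y : R,
    [/\ (x * y) *: c = 0, x *: c <> 0 & y *: c <> 0]).
  apply: (QE (S := multiples (x *: c))).
    have [c' c'V c'E] := multiples_cyclic (x *: c).
    have c'0 (r : R) : (r * x) *: c = 0 -> r *: c' = 0.
      by move=> rx; apply: val_inj; rewrite linearZ /= c'E scalerA rx.
    apply: (IHJ _ c') => // [r rc|].
      by apply: c'0; rewrite mulrC -scalerA rc scaler0.
    by exists y => //; apply: c'0; rewrite mulrC.
  apply: (IHJ _ (proj _ c)).
  - exact: generates_surj (@proj_surj _ _ _) cV.
  - by move=> r rc; rewrite -linearZ rc linear0.
  - exists x => //; rewrite -linearZ; apply/proj0P/multiplesP.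
    by exists 1; rewrite scale1r.
pose qp : R -> bool := fun r => r *: c == 0.
have qi : idealr_closed qp.
  split; first by rewrite unfold_in /qp scale0r.
    by rewrite unfold_in /qp scale1r.
  move=> a u v; rewrite !unfold_in /qp => /eqP u0 /eqP v0.
  by rewrite scalerDl -scalerA u0 v0 scaler0 addr0.
have qpr : prime_idealr_closed qp.
  move=> u v; rewrite !unfold_in /qp => /eqP uv.
  apply: contrapT => /negP; rewrite negb_or => /andP[/eqP u0 /eqP v0].
  by apply: nxy; exists u, v.
apply: (Qprime (q := PrimeIdeal qi qpr) cV).
  by move=> r; split=> /eqP.
move=> V' c' c'V qc' [r rq rc']; apply: (IHJ _ c') => //.
  by move=> s sc; apply: qc'; exact/eqP.
by exists r => //; exact/eqP.
Qed.

(** The inductive form of the existence of prime filtrations. The hypothesis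
    on a module R / q allows assuming Q for all cyclic modules with
    annihilator strictly larger than q, so that Noetherian induction on
    primes is built in. Cyclic modules with a given annihilator replace the
    quotients R / J, which makes Q trivially invariant under the
    isomorphisms involved. *)
Lemma devissage V : fin_gen V -> Q V.
Proof.
move=> [l]; move: {2}(size l) (erefl (size l)) => n.
elim: n V l => [|n IHn] V [|x l] //=.
  by move=> _ lV; apply: Q0 => y; apply/span_nil.
move=> [ln] lV; apply: (QE (S := multiples x)).
  by have [c cV _] := multiples_cyclic x; exact: devissage_cyclic cV.
apply: (IHn _ (map (proj _) l)) => [|z]; first by rewrite size_map.
have [y <-] := proj_surj z; have /span_cons[r yr] := lV y.
rewrite -(subrK (r *: x) y) linearD [X in _ + X](_ : _ = 0) ?addr0.
  exact: span_map.
by apply/proj0P/multiplesP; exists r.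
Qed.

End Principle.

(** Induction on the number of generators of N. If q contains the
    annihilator of the quotient of N by its first generator x, the induction
    hypothesis gives a map on this quotient. Otherwise some t outside q maps
    N into R x, and t y = r x defines the map y |-> r c: it is well defined
    because r x = 0 implies r t N = 0, hence r t and so r lie in q, and it
    maps x to t c, which is not zero. *)
Lemma nonzero_hom_to_prime N C (c : C) q : fin_gen N -> contained (annih N) q ->
  generates c ->
  (forall r : R, r \in (q : pred R) <-> r *: c = 0) ->
  exists h : {linear N -> C}, exists y, h y <> 0.
Proof.
move=> [l + + cC cq]; move: {2}(size l) (erefl (size l)) => n.
elim: n N l => [|n IHn] N [|x l] //=.
  move=> _ lN Nq; have := idealr1 q; rewrite Nq//; apply/annihP => y.
  by rewrite scale1r; exact/span_nil.
move=> [ln] lN Nq; have [|/existsNP[t /not_implyP[tN' tq]]] :=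
    pselect (contained (annih (quotm (multiples x))) q).
  move=> /(IHn _ (map (proj _) l))[|z|h [y hy]]; first by rewrite size_map.
    2: by have [z zy] := proj_surj y; exists (h \o proj _), z; rewrite /= zy.
  have [y <-] := proj_surj z; have /span_cons[r yr] := lN y.
  rewrite -(subrK (r *: x) y) linearD [X in _ + X](_ : _ = 0) ?addr0.
    exact: span_map.
  by apply/proj0P/multiplesP; exists r.
have tNx (y : N) : exists r : R, t *: y = r *: x.
  move/annihP: tN' => /(_ (proj _ y)).
  by rewrite -linearZ => /proj0P/multiplesP.
have x_faithful (r : R) : r *: x = 0 -> r *: c = 0.
  move=> rx; apply/cq.
  have : r * t \in (q : pred R).
    apply: Nq; apply/annihP => y; rewrite -scalerA; have [s ->] := tNx y.
    by rewrite scalerA mulrC -scalerA rx scaler0.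
  by rewrite prime_idealrM => /orP[|/tq].
have /choice[rho rhoP] := tNx.
have hL : linear (fun y => rho y *: c).
  move=> a y z; apply/eqP; rewrite -subr_eq0 scalerA -scalerDl -scalerBl.
  apply/eqP/x_faithful; rewrite scalerBl scalerDl -scalerA -!rhoP.
  by rewrite scalerDr !scalerA mulrC subrr.
exists (mkLin hL); exists x => /= rx; apply: tq; apply/cq.
have /x_faithful : (rho x - t) *: x = 0 by rewrite scalerBl -rhoP subrr.
by rewrite scalerBl rx sub0r => /eqP; rewrite oppr_eq0 => /eqP.
Qed.

End Devissage.

(** * The long exact sequence of Ext in the first variable *)

Section Classes.
Variables (R : comNzRingType) (C : cochain R) (i : nat).

(** Cohomology classes are handled through representing cocycles; [class0P]
    and [class_eqP] turn equalities of classes into coboundary conditions. *)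
Definition class (z : C i) (dz : cdiff C i z = 0) : cohomology C i :=
  proj (coboundary (C := C) (i := i)) (Sub z (introT eqP dz)).

Lemma class_surj (u : cohomology C i) : exists z dz, u = @class z dz.
Proof.
have [z <-] := proj_surj u; have dz := eqP (valP z).
by exists (val z), dz; congr proj; apply: val_inj.
Qed.

Lemma class0P (z : C i) dz : @class z dz = 0 <-> is_coboundary z.
Proof.
by rewrite /class; split=> [/proj0P/asboolP|zb]; [|exact/proj0P/asboolP].
Qed.

Lemma class_linear (a : R) (y z : C i) dy dz d :
  @class (a *: y + z) d = a *: @class y dy + @class z dz.
Proof. by rewrite /class -linearP; congr (proj _ _); apply: val_inj. Qed.

Lemma cocycleP (a : R) (y z : C i) :
  cdiff C i y = 0 -> cdiff C i z = 0 -> cdiff C i (a *: y + z) = 0.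
Proof. by move=> dy dz; rewrite linearP dy dz scaler0 addr0. Qed.

Lemma class_eqP (y z : C i) dy dz :
  @class y dy = @class z dz <-> is_coboundary (y - z).
Proof.
have d : cdiff C i (y - z) = 0 by rewrite linearB /= dy dz subrr.
have <- := @class0P _ d.
suff -> : class d = class dy - class dz.
  by split=> [->|/eqP]; [rewrite subrr|rewrite subr_eq0 => /eqP].
by rewrite /class -linearB; congr (proj _ _); apply: val_inj.
Qed.

Lemma classZ (r : R) (z : C i) dz d :
  @class (r *: z) d = r *: @class z dz.
Proof. by rewrite /class -linearZ; congr (proj _ _); apply: val_inj. Qed.

Lemma scale_class0P (r : R) (z : C i) dz :
  r *: @class z dz = 0 <-> is_coboundary (r *: z).
Proof.
have d : cdiff C i (r *: z) = 0 by rewrite linearZ /= dz scaler0.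
by rewrite -(classZ dz d); exact: class0P.
Qed.

End Classes.

Lemma cohomology_map_class (R : comNzRingType) (C D : cochain R)
    (F : cochain_map C D) i (z : C i) dz dFz :
  cohomology_map F i (@class R C i z dz) = @class R D i (F i z) dFz.
Proof.
by apply: etrans (qliftE _ _) _; congr (proj _ _); apply: val_inj.
Qed.

Section LongExactSequence.
Variables (R : comNzRingType) (I : cochain R).
Hypothesis Iinj : forall i, injective_module (I i).
Variables (A B C : lmodType R) (f : {linear A -> B}) (g : {linear B -> C}).
Hypothesis f_inj : injective f.
Hypothesis g_surj : forall z, exists y, g y = z.
Hypothesis fg_exact : forall y, g y = 0 <-> exists x, y = f x.

Definition lin_hom (M N : lmodType R) (h : {linear M -> N}) : Hom M N :=
  Sub (h : M -> N) (asboolT (linearP h)).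

(** The cochains [hom_cochain N I] compute Ext(N, X) when [I] is an
    injective resolution of X. Exactness in the first variable only needs
    the terms of [I] to be injective, so that every cochain on A extends to
    B. *)
Definition pull (M N : lmodType R) (h : {linear M -> N}) i :
    {linear hom_cochain N I i -> hom_cochain M I i} := hom_map idfun h.

Lemma pullE (M N : lmodType R) (h : {linear M -> N}) i
    (u : hom_cochain N I i) x :
  val (pull h i u) x = val u (h x).
Proof. by []. Qed.

Lemma homE (N : lmodType R) i (u v : hom_cochain N I i) :
  (forall x, val u x = val v x) -> u = v.
Proof. by move=> uv; apply: val_inj; apply/funext. Qed.

Lemma homZE (N : lmodType R) i (s : R) (u : hom_cochain N I i) x :
  val (s *: u) x = s *: val u x.
Proof. by []. Qed.

Lemma pull_diff (M N : lmodType R) (h : {linear M -> N}) i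
    (u : hom_cochain N I i) :
  pull h i.+1 (cdiff _ i u) = cdiff _ i (pull h i u).
Proof. exact: homE. Qed.

Lemma cocycle_pull (M N : lmodType R) (h : {linear M -> N}) i
    (u : hom_cochain N I i) :
  cdiff (hom_cochain N I) i u = 0 ->
  cdiff (hom_cochain M I) i (pull h i u) = 0.
Proof.
move=> du; rewrite -pull_diff.
exact: etrans (congr1 (pull h i.+1) du) (linear0 _).
Qed.

Lemma cocycleZ (N : lmodType R) i (s : R)
    (u : hom_cochain N I i) :
  cdiff (hom_cochain N I) i u = 0 -> cdiff (hom_cochain N I) i (s *: u) = 0.
Proof.
move=> du; apply: etrans (linearZ_LR (cdiff (hom_cochain N I) i) s u) _.
exact: etrans (congr1 _ du) (scaler0 _ _).
Qed.

Lemma coboundary_pullZ (M N : lmodType R) (h : {linear M -> N}) i (s : R)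
    (u : hom_cochain N I i) :
  is_coboundary (s *: pull h i u) -> is_coboundary (pull h i (s *: u)).
Proof. by move=> su; rewrite linearZ. Qed.

Lemma pull_g_inj i u : pull g i u = 0 -> u = 0.
Proof.
move=> u0; apply: homE => z; have [y <-] := g_surj z.
by rewrite -pullE u0.
Qed.

Lemma pull_gf i u : pull f i (pull g i u) = 0.
Proof.
apply: homE => x; rewrite !pullE.
have /fg_exact -> : exists x', f x = f x' by exists x.
exact: (linear0 (mkLin (homP u))).
Qed.

Lemma pull_extend i (u : hom_cochain A I i) : exists v, pull f i v = u.
Proof.
have [h hP] := Iinj (mkLin (homP u)) f_inj.
by exists (lin_hom h); apply: homE => x; exact: hP.
Qed.

Lemma pull_descend i (u : hom_cochain B I i) :
  pull f i u = 0 -> exists v, pull g i v = u.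
Proof.
move=> u0; pose u' := mkLin (homP u).
have u'0 y : g y = 0 -> u' y = 0.
  by move=> /fg_exact[x ->]; rewrite -[LHS]/(val (pull f i u) x) u0.
have /choice[s sP] := g_surj.
have uE y z : g y = g z -> u' y = u' z.
  move=> yz; apply/eqP; rewrite -subr_eq0 -linearB; apply/eqP/u'0.
  by rewrite linearB yz subrr.
have hL : linear (fun z => u' (s z)).
  by move=> a y z; rewrite -linearP; apply: uE; rewrite linearP !sP.
by exists (lin_hom (mkLin hL)); apply: homE => y; apply: uE; rewrite sP.
Qed.

Lemma coboundary_pull (M N : lmodType R) (h : {linear M -> N}) i u :
  is_coboundary u -> is_coboundary (pull h i u).
Proof. exact: (@is_coboundary_map _ _ _ (hom_precomp h I)). Qed.

(** Exactness at Ext^i(B): a cocycle on B whose restriction to A is d c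
    becomes, after subtracting d c' for an extension c' of c to B, a cocycle
    that vanishes on A. *)
Lemma exact_middle i (u : hom_cochain B I i) : cdiff _ i u = 0 ->
  is_coboundary (pull f i u) ->
  exists v, cdiff _ i v = 0 /\ is_coboundary (u - pull g i v).
Proof.
have lift (w : hom_cochain B I i) : pull f i w = 0 -> cdiff _ i w = 0 ->
    exists2 v, cdiff _ i v = 0 & pull g i v = w.
  move=> fw dw; have [v vw] := pull_descend fw; exists v => //.
  by apply: pull_g_inj; rewrite pull_diff vw.
case: i u lift => [|i] u lift du.
  move=> fu; have [v dv vE] := lift u fu du; exists v; split=> //.
  by rewrite vE subrr.
move=> [c fu]; have [c' cc'] := pull_extend c.
have [||v dv vE] := lift (u - cdiff _ i c').
- by rewrite linearB pull_diff cc' fu subrr.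
- by rewrite linearB du cdiffK subrr.
exists v; split=> //; exists c'; rewrite vE.
by rewrite opprB addrC subrK.
Qed.

Lemma exact_start (u : hom_cochain C I 0) :
  is_coboundary (pull g 0 u) -> is_coboundary u.
Proof. exact: pull_g_inj. Qed.

(** The connecting map Ext^i(A) -> Ext^(i+1)(C), as a relation between
    representing cochains: the snake lemma passes through a chosen extension
    w of u to B, and a relation records all choices at once. *)
Definition connects i (u : hom_cochain A I i) (v : hom_cochain C I i.+1) :=
  exists w : hom_cochain B I i, pull f i w = u /\ cdiff _ i w = pull g i.+1 v.

Lemma connects_linear i a u u' v v' :
  @connects i u v -> connects u' v' -> connects (a *: u + u') (a *: v + v').
Proof.
move=> [w [wu wv]] [w' [wu' wv']]; exists (a *: w + w').
rewrite -wu -wu'; split; first exact: linearP.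
apply: etrans (linearP (cdiff _ i) a w w') _; rewrite wv wv'.
exact: esym (linearP (pull g i.+1) a v v').
Qed.

Lemma connectsZ i a u v : @connects i u v -> connects (a *: u) (a *: v).
Proof.
have uv0 : @connects i 0 0.
  by exists 0; split; [exact: linear0|rewrite [LHS]linear0; exact/esym/linear0].
by move=> /(connects_linear a)/(_ uv0); rewrite !addr0.
Qed.

Lemma connects_total i (u : hom_cochain A I i) : cdiff _ i u = 0 ->
  exists v, cdiff _ i.+1 v = 0 /\ connects u v.
Proof.
move=> du; have [w wu] := pull_extend u.
have [|v vw] := @pull_descend i.+1 (cdiff _ i w).
  by rewrite pull_diff wu.
exists v; split; last by exists w.
by apply: pull_g_inj; rewrite pull_diff vw cdiffK.
Qed.

(** The connecting map is well defined on classes: if u = d c, then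
    subtracting d c' from w, for an extension c' of c to B, gives a cochain
    with the same differential that comes from C. *)
Lemma connects_coboundary i u v :
  @connects i u v -> is_coboundary u -> is_coboundary v.
Proof.
move=> [w [wu wv]] ub.
suff [w' w'0 dw'] : exists2 w', pull f i w' = 0 & cdiff _ i w' = cdiff _ i w.
  have [x xw'] := pull_descend w'0; exists x.
  by apply/eqP; rewrite -subr_eq0; apply/eqP/pull_g_inj; rewrite linearB
    pull_diff xw' dw' wv subrr.
case: i u v w wu wv ub => [|i] u v w wu wv.
  by move=> u0; exists w; rewrite ?wu.
move=> [c uc]; have [c' cc'] := pull_extend c.
exists (w - cdiff _ i c'); first by rewrite linearB pull_diff cc' wu uc subrr.
by rewrite linearB cdiffK subr0.
Qed.

(** Exactness at Ext^(i+1)(C): if v pulls back to d w on B, the restriction of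
    w to A is a cocycle, and w itself witnesses that it connects to v. *)
Lemma exact_right i (v : hom_cochain C I i.+1) : cdiff _ i.+1 v = 0 ->
  is_coboundary (pull g i.+1 v) -> exists u, cdiff _ i u = 0 /\ connects u v.
Proof.
move=> dv [w wE]; exists (pull f i w); split; last by exists w.
by rewrite -pull_diff -wE pull_gf.
Qed.

(** Exactness at Ext^i(A): if v = d c, subtracting the pullback of c from the
    extension w of u makes it a cocycle on B without changing it on A. *)
Lemma exact_left i (u : hom_cochain A I i) v : connects u v ->
  is_coboundary v -> exists w, cdiff _ i w = 0 /\ pull f i w = u.
Proof.
move=> [w [wu wv]] [c vc]; exists (w - pull g i c).
by rewrite !linearB wu pull_gf subr0 -pull_diff wv vc subrr.
Qed.

End LongExactSequence.

(** * Vanishing of Ext at a prime *)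

Section LocalVanishing.
Variables (R : comNzRingType) (p : Spec R).
Implicit Types V W N : lmodType R.

Definition torsion V (x : V) :=
  exists2 s : R, s \notin (p : pred R) & s *: x = 0.

Definition locally_zero V := forall x : V, torsion x.

Lemma notin_primeM (s t : R) : s \notin (p : pred R) ->
  t \notin (p : pred R) -> s * t \notin (p : pred R).
Proof. by move=> sp tp; rewrite prime_idealrM negb_or sp. Qed.

(** A fraction x / 1 vanishes exactly when an element outside p kills x, so
    p is outside the support when every element is killed in this way. *)
Lemma notSuppP V : ~ Supp V p <-> locally_zero V.
Proof.
split=> [V0 x|V0 [z /eqP]]; last first.
  have [v [s ->]] := fracP z; apply; apply/frac0.
  by have [t tp tv] := V0 v; exists t.
apply: contrapT => nx; apply: V0; exists (frac x (denom1 p)).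
by apply/eqP => /frac0[s sp sx]; apply: nx; exists s.
Qed.

Lemma locally_zero_annih V (s : R) :
  s \notin (p : pred R) -> s \in annih V -> locally_zero V.
Proof. by move=> sp /annihP sV x; exists s. Qed.

Lemma locally_zero_fin_gen V : fin_gen V -> locally_zero V ->
  exists2 s : R, s \notin (p : pred R) & s \in annih V.
Proof.
move=> [l lV] V0.
suff [s sp sl] : exists2 s : R, s \notin (p : pred R) &
    forall x, x \in l -> s *: x = 0.
  exists s => //; apply/annihP => x; have /asboolP[t tl ->] := lV x.
  rewrite scaler_sumr big_seq big1// => y yt.
  by rewrite scalerA mulrC -scalerA sl ?scaler0//; exact: tl.
elim: l {lV} => [|x l [s sp sl]]; first by exists 1; rewrite ?idealr1.
have [t tp tx] := V0 x; exists (s * t); first exact: notin_primeM.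
move=> y; rewrite inE => /predU1P[->|/sl yl].
  by rewrite -scalerA tx scaler0.
by rewrite mulrC -scalerA yl scaler0.
Qed.

End LocalVanishing.

Section ExtVanishing.
Variables (R : comNzRingType) (p : Spec R) (X : lmodType R).
Implicit Types V W N : lmodType R.

Notation I := (can_resolution X).
Notation coch N := (hom_cochain N I).

Lemma resolution_injective i : injective_module (I i).
Proof. exact: ires_injective. Qed.

Definition Ext_zero i N := locally_zero p (Ext i N X).

Lemma Ext_zeroP i N : Ext_zero i N <-> forall u : coch N i,
  cdiff _ i u = 0 ->
  exists2 s : R, s \notin (p : pred R) & is_coboundary (s *: u).
Proof.
split=> [N0 u du|N0 z].
  by have [s sp /scale_class0P su] := N0 (class du); exists s.
have [u [du ->]] := class_surj z; have [s sp su] := N0 u du.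
by exists s => //; apply/scale_class0P.
Qed.

Lemma Ext_zero_annih i N (s : R) :
  s \notin (p : pred R) -> s \in annih N -> Ext_zero i N.
Proof.
move=> sp /annihP sN; apply/Ext_zeroP => u du; exists s => //.
rewrite (_ : s *: u = 0); first exact: is_coboundary0.
apply: homE => x; pose u' := mkLin (homP u).
apply: etrans (homZE s u x) _; rewrite -[val u x]/(u' x) -linearZ_LR sN.
exact: linear0.
Qed.

Section ShortExact.
Variables (A B C : lmodType R) (f : {linear A -> B}) (g : {linear B -> C}).
Hypothesis f_inj : injective f.
Hypothesis g_surj : forall z, exists y, g y = z.
Hypothesis fg_exact : forall y, g y = 0 <-> exists x, y = f x.

Lemma Ext_zero_middle i : Ext_zero i A -> Ext_zero i C -> Ext_zero i B.
Proof.
move=> /Ext_zeroP A0 /Ext_zeroP C0; apply/Ext_zeroP => u du.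
have [|s sp su] := A0 (pull I f i u); first exact: cocycle_pull.
have dsu := cocycleZ s du.
have fsu : is_coboundary (pull I f i (s *: u)).
  exact: coboundary_pullZ.
have [v [dv suv]] :=
  exact_middle resolution_injective f_inj g_surj fg_exact dsu fsu.
have [t tp tv] := C0 v dv; exists (t * s); first exact: notin_primeM.
rewrite -scalerA -(subrK (pull I g i v) (s *: u)) scalerDr.
apply: is_coboundaryP => //.
rewrite [_ *: _](_ : _ = pull I g i (t *: v)); first exact: coboundary_pull.
exact/esym/linearZ.
Qed.

(** The kernel of Ext^i(C) -> Ext^i(B) is a quotient of Ext^(i-1)(A), and is
    0 when i = 0. The hypothesis on all j with i = j.+1 expresses both
    cases. *)
Lemma pull_locally_inj i (u : coch C i) :
  (forall j, i = j.+1 -> Ext_zero j A) -> cdiff _ i u = 0 ->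
  is_coboundary (pull I g i u) ->
  exists2 s : R, s \notin (p : pred R) & is_coboundary (s *: u).
Proof.
case: i u => [|i] u A0 du gu.
  exists 1; first by rewrite idealr1.
  by rewrite scale1r; exact: exact_start gu.
have [v [dv vu]] := exact_right fg_exact du gu.
have [s sp sv] := (Ext_zeroP _ _).1 (A0 i erefl) v dv.
exists s => //; move: sv.
apply: (connects_coboundary resolution_injective f_inj g_surj fg_exact).
exact: connectsZ vu.
Qed.

Lemma Ext_zero_right i :
  (forall j, i = j.+1 -> Ext_zero j A) -> Ext_zero i B -> Ext_zero i C.
Proof.
move=> A0 /Ext_zeroP B0; apply/Ext_zeroP => u du.
have [|s sp su] := B0 (pull I g i u); first exact: cocycle_pull.
have dsu := cocycleZ s du.
have [|t tp tsu] := pull_locally_inj A0 dsu.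
  exact: coboundary_pullZ.
by exists (t * s); [exact: notin_primeM|rewrite -scalerA].
Qed.

End ShortExact.

Lemma Ext_zero_extension i V (S : submodClosed V) :
  Ext_zero i (subm S) -> Ext_zero i (quotm S) -> Ext_zero i V.
Proof.
apply: Ext_zero_middle (@incl_inj _ _ S) (@proj_surj _ _ S) _ _.
by move=> y; rewrite proj0P; exact: inclP.
Qed.

Section Kernel.
Variables (V W : lmodType R) (g : {linear V -> W}).
Hypothesis g_surj : forall z, exists y, g y = z.

Lemma Ext_map_locally_inj i (z : Ext i W X) (s : R) :
  (forall j, i = j.+1 -> Ext_zero j (subm (lkernel g))) ->
  s \notin (p : pred R) -> s *: Ext_map i g X z = 0 ->
  exists2 t : R, t \notin (p : pred R) & t *: z = 0.
Proof.
move=> A0 sp; have [u [du ->]] := class_surj z.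
have dgu : cdiff (coch V) i (pull I g i u) = 0.
  exact: cocycle_pull.
have -> : Ext_map i g X (class du) = class dgu.
  exact: (@cohomology_map_class _ _ _ (hom_precomp g I)).
move=> /scale_class0P sgu.
have dsu := cocycleZ s du.
have [||t tp tsu] :=
  pull_locally_inj (@incl_inj _ _ (lkernel g)) g_surj _ A0 dsu.
- by move=> y; rewrite -(lkernelP g); exact: inclP.
- exact: coboundary_pullZ.
by exists (t * s); [exact: notin_primeM|apply/scale_class0P; rewrite -scalerA].
Qed.

Lemma Ext_zero_image i :
  (forall j, i = j.+1 -> Ext_zero j (subm (lkernel g))) ->
  Ext_zero i V -> Ext_zero i W.
Proof.
apply: Ext_zero_right (@incl_inj _ _ (lkernel g)) g_surj _ _.
by move=> y; rewrite -(lkernelP g); exact: inclP.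
Qed.

End Kernel.

End ExtVanishing.

(** * Vanishing of Ext depends only on the support *)

Section Support.
Variables (R : comNzRingType) (noethR : noetherian R).
Variables (p : Spec R) (X : lmodType R).
Implicit Types V W N : lmodType R.

(** For finitely generated modules the support consists of the primes that
    contain the annihilator, so this is the inclusion of Supp N' in Supp N. *)
Definition supp_le N' N := forall q : Spec R,
  contained (annih N') q -> contained (annih N) q.

Lemma supp_le_inj V W N (f : {linear V -> W}) :
  injective f -> supp_le W N -> supp_le V N.
Proof.
by move=> fi WN q Vq; apply: WN => r rW; apply: Vq; exact: annih_inj fi rW.
Qed.

Lemma supp_le_surj V W N (f : {linear V -> W}) :
  (forall w, exists v, f v = w) -> supp_le V N -> supp_le W N.
Proof.
by move=> fs VN q Wq; apply: VN => r rV; apply: Wq; exact: annih_surj fs rV.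
Qed.

Lemma corestrict_subproof V W (h : {linear V -> W}) x : h x \in limage h.
Proof. by apply/limageP; exists x. Qed.

Lemma corestrict_linear V W (h : {linear V -> W}) :
  linear (fun x => Sub (h x) (corestrict_subproof h x) : subm (limage h)).
Proof. by move=> a x y; apply: val_inj; rewrite /= linearP. Qed.

Definition corestrict V W (h : {linear V -> W}) :
  {linear V -> subm (limage h)} := mkLin (corestrict_linear h).

Lemma corestrict_surj V W (h : {linear V -> W}) z :
  exists x, corestrict h x = z.
Proof.
have /limageP[x xz] := valP z; exists x.
by apply: val_inj; rewrite xz.
Qed.

(** By devissage it suffices to treat a cyclic module C with prime
    annihilator q in Supp N. A nonzero h : N -> C exists. Its image is a
    quotient of N by a module supported in Supp N, for which Ext^(i-1)
    vanishes at p, so Ext^i of the image vanishes at p; the cokernel of h is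
    cyclic with an annihilator strictly larger than q, so the devissage
    hypothesis applies to it; and C is an extension of the cokernel by the
    image. *)
Lemma Ext_zero_support_step i N : fin_gen N ->
  (forall j, i = j.+1 -> forall N', fin_gen N' -> supp_le N' N ->
     Ext_zero p X j N') ->
  Ext_zero p X i N ->
  forall N', fin_gen N' -> supp_le N' N -> Ext_zero p X i N'.
Proof.
move=> fgN IHi N0; apply: (devissage noethR) => [V V0 _|V S SN QN VN|].
- apply: (@Ext_zero_annih _ _ _ _ _ 1); first by rewrite idealr1.
  by apply/annihP => x; exact: V0.
- apply: (Ext_zero_extension (S := S)); first apply: SN; last apply: QN.
    exact: supp_le_inj (@incl_inj _ _ S) VN.
  exact: supp_le_surj (@proj_surj _ _ S) VN.
move=> q V c cV cq IHV VN.
have Nq : contained (annih N) q.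
  by apply: VN => r /annihP rV; apply/cq.
have [h [y hy]] := nonzero_hom_to_prime fgN Nq cV cq.
apply: (Ext_zero_extension (S := limage h)).
  apply: (Ext_zero_image (@corestrict_surj _ _ h)) => // j ij.
  apply: (IHi _ ij); first exact: fin_gen_subm.
  exact: supp_le_inj (@incl_inj _ _ _) (fun q' Nq' => Nq').
have [r hr] := cV (h y).
apply: (IHV _ (proj (limage h) c)).
- exact: generates_surj (@proj_surj _ _ _) cV.
- by move=> s /cq sc; rewrite -linearZ sc linear0.
- exists r; first by apply/negP => /cq; rewrite -hr.
  by rewrite -linearZ -hr; apply/proj0P/limageP; exists y.
- exact: supp_le_surj (@proj_surj _ _ _) VN.
Qed.

(** Induction on i, since the step in degree i uses the vanishing in degree
    i - 1 for all modules with support in Supp N. With equal supports it says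
    that this vanishing is a property of the support alone. *)
Lemma Ext_zero_support n N : fin_gen N ->
  (forall i, (i <= n)%N -> Ext_zero p X i N) ->
  forall N', fin_gen N' -> supp_le N' N ->
  forall i, (i <= n)%N -> Ext_zero p X i N'.
Proof.
move=> fgN N0 N' + + i; elim: i N' => [|i IHi] N' fgN' NN' ilen.
  by apply: (Ext_zero_support_step fgN) => //; exact: N0.
apply: (Ext_zero_support_step fgN) => //; last exact: N0.
by move=> j [<-] L fgL LN; apply: IHi => //; exact: ltnW.
Qed.

End Support.

(** * Nakayama's lemma at a prime *)

Section Nakayama.
Variables (R : comNzRingType) (q : Spec R).
Implicit Types (V : lmodType R) (b : ideal R).

Lemma torsion0 V : torsion q (0 : V).
Proof. by exists 1; rewrite ?scaler0// idealr1. Qed.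

Lemma torsionD V (c : R) (x y : V) :
  torsion q x -> torsion q y -> torsion q (c *: x + y).
Proof.
move=> [s sq sx] [t tq ty]; exists (s * t); first exact: notin_primeM.
rewrite scalerDr -[X in _ + X]scalerA ty scaler0 addr0 scalerA.
by rewrite (_ : s * t * c = t * c * s) -?scalerA ?sx ?scaler0//; ring.
Qed.

Lemma mulsm_cons V b (x : V) (l : seq V) z : z \in mulsm b [set` x :: l] ->
  exists2 r : R, r \in b & z - r *: x \in mulsm b [set` l].
Proof.
pose P z := exists2 r : R, r \in b & z - r *: x \in mulsm b [set` l].
have P0 : P 0 by exists 0; [exact: rpred0|rewrite scale0r subr0 rpred0].
have PD c u v : P u -> P v -> P (c *: u + v).
  move=> [r rb ur] [s sb vs]; exists (c * r + s).
    by apply: rpredD => //; exact: (rpredZ c rb).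
  rewrite scalerDl opprD addrACA -scalerA -scalerBr.
  by apply: rpredD => //; exact: rpredZ.
move=> zl; apply/(submod_ofP P0 PD); move: z zl; apply: span_min.
move=> _ [r [y [rb + ->]]]; rewrite /= inE => yl; apply/(submod_ofP P0 PD).
case/predU1P: yl => [->|yl].
  by exists r => //; rewrite subrr rpred0.
exists 0; first exact: rpred0.
by rewrite scale0r subr0; apply: span_gen; exists r, y.
Qed.

(** Induction on l. From s x in b x + b l', with s outside q, the element t
    = s - r for some r in b satisfies t x in b l' and is outside q.
    Multiplying the relations of the other generators by t removes x from
    them, so these generators are torsion by induction, and then so are t x
    and x. *)
Lemma nakayama_seq V b (l : seq V) :
  contained b q ->
  (forall x, x \in l -> exists2 s : R, s \notin (q : pred R) &
     s *: x \in mulsm b [set` l]) ->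
  forall x, x \in l -> torsion q x.
Proof.
move=> bq; elim: l => [//|x l IHl] lb.
have [s sq /mulsm_cons[r rb sx]] := lb x (mem_head _ _).
rewrite -scalerBl in sx.
have tq : s - r \notin (q : pred R).
  by apply: contra sq => srq; rewrite -(subrK r s) rpredD// bq.
have {}IHl y : y \in l -> torsion q y.
  apply: IHl => {}y yl; have [|u uq] := lb y; first by rewrite inE yl orbT.
  move=> /mulsm_cons[v vb uy]; exists ((s - r) * u); first exact: notin_primeM.
  rewrite -scalerA -(subrK (v *: x) (u *: y)) scalerDr.
  apply: rpredD; first exact: rpredZ.
  by rewrite scalerA mulrC -scalerA; exact: rpredZ.
move=> y; rewrite inE => /predU1P[{y}->|/IHl//].
suff [t t_q tx] : torsion q ((s - r) *: x).
  by exists (t * (s - r)); [exact: notin_primeM|rewrite -scalerA].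
apply/(submod_ofP (torsion0 V) (@torsionD V)).
move: sx; apply: span_min => _ [v [y [_ yl ->]]]; apply: rpredZ.
exact/(submod_ofP (torsion0 V) (@torsionD V))/IHl.
Qed.

Lemma nakayama V b : fin_gen V ->
  contained b q ->
  (forall x : V, exists2 s : R, s \notin (q : pred R) &
     s *: x \in idealM b V) ->
  locally_zero q V.
Proof.
move=> [l lV] bq Vb.
suff lt x : x \in l -> torsion q x.
  move=> x; apply/(submod_ofP (torsion0 V) (@torsionD V)).
  move: (lV x); apply: span_min => y yl.
  exact/(submod_ofP (torsion0 V) (@torsionD V))/lt.
apply: (nakayama_seq bq) => y _; have [s sq sy] := Vb y; exists s => //.
move: sy; apply: span_min => _ [r [z [rb _ ->]]].
have /asboolP[t tl ->] := lV z; rewrite scaler_sumr big_seq.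
apply: rpred_sum => u ut; rewrite scalerA mulrC -scalerA; apply: rpredZ.
by apply: span_gen; exists r, u.2; split=> //; exact: tl.
Qed.

(** Nakayama's lemma computes the support of V / b V: if q contains b and r
    outside q kills V / b V, then r V lies in b V, so V vanishes at q. *)
Lemma annih_quotient V b : fin_gen V ->
  contained (annih (quotm (idealM b V))) q <->
  contained b q /\ contained (annih V) q.
Proof.
move=> fgV; split=> [Vq|[bq Vq] r /annihP rV].
  split=> r rb; apply: Vq; last exact: annih_surj (@proj_surj _ _ _) rb.
  apply/annihP => z; have [x <-] := proj_surj z; rewrite -linearZ.
  by apply/proj0P/span_gen; exists r, x.
apply: contraT => rq.
have /(locally_zero_fin_gen fgV)[s sq /Vq sV] : locally_zero q V.
  apply: (nakayama fgV bq) => x; exists r => //; apply/proj0P.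
  by rewrite linearZ; exact: rV.
by rewrite sV in sq.
Qed.

Lemma expr_idealX (a : ideal R) (r : R) k : r \in a -> r ^+ k \in idealX a k.
Proof.
move=> ra; elim: k => [|k IHk]; first exact: span_gen.
by rewrite exprS; apply: span_gen; exists r, (r ^+ k).
Qed.

Lemma idealX_prime (a : ideal R) k :
  contained (idealX a k.+1) q <-> contained a q.
Proof.
split=> [aq r ra|aq r ra].
  have := aq _ (expr_idealX k.+1 ra); elim: k {aq} => [|k IHk].
    by rewrite expr1.
  by rewrite exprS prime_idealrM => /orP[|/IHk].
apply: aq; move: r ra; apply: (@span_min R R^o) => _ [r [y [ra _ ->]]].
by rewrite /GRing.scale /= mulrC; exact: (rpredZ y ra).
Qed.

End Nakayama.

(** * Local cohomology and Ext *)

Section LocalCohomologyExt.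
Variables (R : comNzRingType) (noethR : noetherian R) (p : Spec R).
Variables (a : ideal R) (M X : lmodType R).
Hypothesis fgM : fin_gen M.

Notation Mpow k := (quotm (idealM (idealX a k) M)).

Lemma supp_le_pow k : supp_le (Mpow k) (quotm (idealM a M)).
Proof.
move=> q /(annih_quotient q _ fgM)[akq Mq].
apply/(annih_quotient q _ fgM); split=> //; case: k akq => [|k].
  by move=> /(_ 1 (span_gen I)); rewrite idealr1.
by move/idealX_prime.
Qed.

Lemma supp_le_pow1 : supp_le (quotm (idealM a M)) (Mpow 1).
Proof.
move=> q /(annih_quotient q _ fgM)[aq Mq].
apply/(annih_quotient q _ fgM); split=> //; exact/idealX_prime.
Qed.

Lemma power_proj_surj k z : exists y, power_proj a M k y = z.
Proof.
by have [x <-] := proj_surj z; exists (proj _ x); rewrite /power_proj qliftE.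
Qed.

Lemma Mpow_fin_gen k : fin_gen (Mpow k).
Proof. exact: fin_gen_quotm. Qed.

Section Degree.
Variable i : nat.
Hypothesis Ext_lower : forall j, i = j.+1 -> forall N, fin_gen N ->
  supp_le N (quotm (idealM a M)) -> Ext_zero p X j N.

Notation D := (fun k => Ext i (Mpow k) X).
Notation f := (fun k => Ext_map i (power_proj a M k) X).

(** The kernel of M / a^(j+1) M -> M / a^j M is supported in Supp (M / a M),
    so its Ext^(i-1) vanishes at p and the transition maps of the direct
    system are injective at p. *)
Lemma push_locally_inj k (x : D k) j :
  (k <= j)%N -> torsion p (push (D := D) f x j) -> torsion p x.
Proof.
elim: j => [|j IHj].
  by rewrite leqn0 => /eqP e; case: _ / e x => x; rewrite push_id.
rewrite leq_eqVlt => /predU1P[e|]; first by case: _ / e; rewrite push_id.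
rewrite ltnS => kj; rewrite (push_step f x kj) => -[s sp sx]; apply: IHj => //.
apply: (Ext_map_locally_inj (@power_proj_surj j) _ sp sx) => l il.
apply: (Ext_lower il); first exact/fin_gen_subm/Mpow_fin_gen.
exact: supp_le_inj (@incl_inj _ _ _) (@supp_le_pow _).
Qed.

(** The system is taken from stage 1 on: its stage 0 is Ext^i(M / a^0 M, X)
    = 0, whereas M / a^1 M has the support of M / a M. *)
Lemma gen_loc_coh_zero_Ext :
  locally_zero p (gen_loc_coh i a M X) -> Ext_zero p X i (Mpow 1).
Proof.
move=> H0 x; have [s sp] := H0 (germ (D := D) f 1 x).
rewrite -linearZ => /germ_eq0[j j1 sx].
have [|t tp tx] := @push_locally_inj 1 (s *: x) j j1.
  by rewrite sx; exact: torsion0.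
by exists (t * s); [exact: notin_primeM|rewrite -scalerA].
Qed.

End Degree.

(** All the modules M / a^k M are supported in Supp (M / a M). Hence the
    vanishing of Ext^i(M / a M, X) at p for i <= n passes to every stage of
    the limit. Conversely, if these Ext vanish at p below degree n, then the
    transition maps in degree n are injective at p, and a limit that
    vanishes at p forces its stages to do so. *)
Lemma gen_loc_coh_zeroP n :
  (forall i, (i <= n)%N -> locally_zero p (gen_loc_coh i a M X)) <->
  (forall i, (i <= n)%N -> Ext_zero p X i (quotm (idealM a M))).
Proof.
have fgMa : fin_gen (quotm (idealM a M)) by exact: fin_gen_quotm.
split=> [H0|E0 i ilen z]; last first.
  have [k [x ->]] := germ_surj z.
  have [s sp sx] := Ext_zero_support noethR fgMa E0 (Mpow_fin_gen k)
    (@supp_le_pow k) ilen x.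
  by exists s => //; rewrite -linearZ sx linear0.
elim: n H0 => [|n IHn] H0 i.
  rewrite leqn0 => /eqP ->.
  apply: (Ext_zero_support noethR (Mpow_fin_gen 1) _ fgMa supp_le_pow1
    (leqnn 0)) => j.
  rewrite leqn0 => /eqP ->.
  by apply: gen_loc_coh_zero_Ext => //; exact: H0.
have {}IHn := IHn (fun i ilen => H0 i (leqW ilen)).
rewrite leq_eqVlt ltnS => /predU1P[->|/IHn//].
apply: (Ext_zero_support noethR (Mpow_fin_gen 1) _ fgMa supp_le_pow1
  (leqnn n.+1)) => j.
have lower l : (l <= n)%N -> forall N, fin_gen N ->
    supp_le N (quotm (idealM a M)) -> Ext_zero p X l N.
  by move=> ln N fgN NM; exact: (Ext_zero_support noethR fgMa IHn fgN NM).
rewrite leq_eqVlt ltnS => /predU1P[->|jn].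
  apply: gen_loc_coh_zero_Ext; last exact: H0.
  by move=> _ [<-]; exact: lower.
by apply: lower (Mpow_fin_gen 1) (@supp_le_pow 1).
Qed.

End LocalCohomologyExt.

(** * Finite generation of Ext *)

Section Connecting.
Variables (R : comNzRingType) (X : lmodType R).
Notation I := (can_resolution X).
Notation coch N := (hom_cochain N I).
Variables (A B C : lmodType R) (f : {linear A -> B}) (g : {linear B -> C}).
Hypothesis f_inj : injective f.
Hypothesis g_surj : forall z, exists y, g y = z.
Hypothesis fg_exact : forall y, g y = 0 <-> exists x, y = f x.

(** The relation [connects] descends to a linear map on classes, which is
    needed to transport finite generation. *)
Lemma connecting_map i : exists delta : {linear Ext i A X -> Ext i.+1 C X},
  forall u v du dv, connects f g u v ->
    delta (@class _ (coch A) i u du) = @class _ (coch C) i.+1 v dv.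
Proof.
have Iinj := @resolution_injective _ X.
have /choice[d dP] : forall z : Ext i A X, exists w : Ext i.+1 C X,
    exists u v du dv, [/\ z = @class _ (coch A) i u du,
      w = @class _ (coch C) i.+1 v dv & connects f g u v].
  move=> z; have [u [du ->]] := class_surj z.
  have [v [dv uv]] := connects_total Iinj f_inj g_surj fg_exact du.
  by exists (class dv), u, v, du, dv.
have dE u v du dv : connects f g u v ->
    d (@class _ (coch A) i u du) = @class _ (coch C) i.+1 v dv.
  move=> uv.
  have [u' [v' [du' [dv' [/class_eqP uu' -> uv']]]]] := dP (class du).
  apply/esym/class_eqP.
  rewrite (_ : v - v' = -1 *: v' + v); last by rewrite scaleN1r addrC.
  apply: (connects_coboundary Iinj f_inj g_surj fg_exact
    (connects_linear (-1) uv' uv)).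
  by rewrite scaleN1r addrC.
have dL : linear d.
  move=> a z z'; have [u [v [du [dv [-> -> uv]]]]] := dP z.
  have [u' [v' [du' [dv' [-> -> uv']]]]] := dP z'.
  have du2 := cocycleP a du du'; have dv2 := cocycleP a dv dv'.
  rewrite -(class_linear du du' du2) -(class_linear dv dv' dv2).
  exact/dE/connects_linear.
by exists (mkLin dL) => u v du dv uv; exact: dE.
Qed.

(** Dimension shifting: when Ext^(i+1)(B, X) = 0 the connecting map is onto. *)
Lemma Ext_fin_gen_step i :
  (forall w : coch B i.+1, cdiff _ i.+1 w = 0 -> is_coboundary w) ->
  fin_gen (Ext i A X) -> fin_gen (Ext i.+1 C X).
Proof.
move=> B0; have [d dE] := connecting_map i.
apply: (fin_gen_surj (f := d)) => w; have [v [dv ->]] := class_surj w.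
have [u [du uv]] := exact_right fg_exact dv (B0 _ (cocycle_pull g dv)).
by exists (class du); exact: dE.
Qed.

End Connecting.

Section FreeModules.
Variables (R : comNzRingType) (m : nat).
Implicit Types V W N X : lmodType R.

Notation F := {ffun 'I_m -> R^o}.

Definition basis (j : 'I_m) : F := [ffun k => (k == j)%:R].

Lemma basis_expand (v : F) : v = \sum_j (v j : R) *: basis j.
Proof.
apply/ffunP => k; rewrite sum_ffunE (bigD1 k)//= big1 => [|j jk].
  by rewrite !ffunE eqxx addr0 /GRing.scale /= mulr1.
by rewrite !ffunE eq_sym (negPf jk) scaler0.
Qed.

Lemma free_map_linear V (y : 'I_m -> V) :
  linear (fun v : F => \sum_j (v j : R) *: y j).
Proof.
move=> a u v; rewrite scaler_sumr -big_split; apply: eq_bigr => j _.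
by rewrite !ffunE scalerDl scalerA.
Qed.

Definition free_map V (y : 'I_m -> V) : {linear F -> V} :=
  mkLin (free_map_linear y).

Lemma free_fin_gen V : fin_gen V -> fin_gen {ffun 'I_m -> V}.
Proof.
move=> [l lV].
have deltaL (i : 'I_m) : linear (fun x : V =>
    [ffun k => if k == i then x else 0] : {ffun 'I_m -> V}).
  move=> a x y; apply/ffunP => k; rewrite !ffunE.
  by case: eqP; rewrite // scaler0 addr0.
exists (flatten [seq map (mkLin (deltaL i)) l | i <- enum 'I_m]) => v.
have -> : v = \sum_i mkLin (deltaL i) (v i).
  apply/ffunP => k; rewrite sum_ffunE (bigD1 k)//= big1 => [|j jk].
    by rewrite ffunE eqxx addr0.
  by rewrite ffunE eq_sym (negPf jk).
apply: rpred_sum => i _.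
have := span_map (mkLin (deltaL i)) (lV (v i)); apply: span_sub => x xl.
apply/flattenP; exists (map (mkLin (deltaL i)) l) => //.
by apply/mapP; exists i; rewrite ?mem_enum.
Qed.

(** Lifting the values of a cocycle on the basis, by exactness of the
    resolution, gives a cochain that bounds it. *)
Lemma free_coboundary X i (u : hom_cochain F (can_resolution X) i.+1) :
  cdiff _ i.+1 u = 0 -> is_coboundary u.
Proof.
move=> du; pose u' := mkLin (homP u).
have /choice[y yP] : forall j, exists y, u' (basis j) =
    cdiff (can_resolution X) i y.
  move=> j; apply/ires_exact.
  exact: (congr1 (fun w : Hom F _ => val w (basis j)) du).
exists (lin_hom (free_map y)); apply: homE => v.
rewrite -[LHS]/(u' v) [in LHS](basis_expand v) linear_sum.
apply: etrans (esym (linear_sum (cdiff (can_resolution X) i) _ _ _)).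
by apply: eq_bigr => j _; rewrite !linearZ_LR yP.
Qed.

End FreeModules.

Section ExtFinGen.
Variables (R : comNzRingType) (noethR : noetherian R).
Implicit Types V W N X : lmodType R.

Lemma presentation N : fin_gen N ->
  exists m (g : {linear {ffun 'I_m -> R^o} -> N}),
    (forall z, exists y, g y = z) /\ fin_gen (subm (lkernel g)).
Proof.
move=> [l lN]; exists (size l), (free_map (fun j => l`_j)); split=> [z|].
  have /span_nth[u ->] := lN z; exists [ffun j => u j].
  by apply: eq_bigr => j _; rewrite ffunE.
apply: (fin_gen_subm noethR); apply: free_fin_gen; exact: fin_gen_regular.
Qed.

(** A homomorphism is determined by its values on generators of N. *)
Lemma Hom_fin_gen N X : fin_gen N -> fin_gen X -> fin_gen (Hom N X).
Proof.
move=> [l lN] fgX.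
have evL : linear (fun h : Hom N X =>
    [ffun j : 'I_(size l) => val h l`_j] : {ffun 'I_(size l) -> X}).
  by move=> a h h'; apply/ffunP => j; rewrite !ffunE.
apply: (fin_gen_inj noethR (f := mkLin evL)); last exact: free_fin_gen.
apply: raddf_inj => h h0; apply: val_inj; apply/funext => x.
have /span_nth[u ->] := lN x; pose h' := mkLin (homP h).
rewrite -[LHS]/(h' _) linear_sum big1// => j _; rewrite linearZ_LR.
have := congr1 (fun v : {ffun 'I_(size l) -> X} => v j) h0.
by rewrite !ffunE => hj; rewrite [h' _]hj scaler0.
Qed.

Lemma cocycle0_factor N X (u : hom_cochain N (can_resolution X) 0) :
  cdiff _ 0 u = 0 ->
  exists h : {linear N -> X}, forall x, val u x = iaug (can_resolution X) (h x).
Proof.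
move=> du; have /choice[h hP] : forall x, exists y,
    val u x = iaug (can_resolution X) y.
  move=> x; apply/iaug_exact.
  exact: (congr1 (fun w : Hom N _ => val w x) du).
have hL : linear h.
  move=> a x y; apply: (@iaug_inj _ _ (can_resolution X)).
  by rewrite linearP -!hP; exact: homP.
by exists (mkLin hL).
Qed.

Lemma augment_cocycle N X (h : Hom N X) :
  cdiff (hom_cochain N (can_resolution X)) 0
    (hom_map (iaug (can_resolution X)) idfun h) = 0.
Proof. by apply: homE => x; apply/iaug_exact; exists (val h x). Qed.

(** Dimension shifting along 0 -> K -> R^m -> N -> 0, where K is finitely
    generated again, reduces to Ext^0(N, X), which is a quotient of Hom(N,
    X). *)
Lemma Ext_fin_gen X i N : fin_gen X -> fin_gen N -> fin_gen (Ext i N X).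
Proof.
move=> fgX; elim: i N => [|i IHi] N fgN; last first.
  have [m [g [g_surj fgK]]] := presentation fgN.
  apply: (Ext_fin_gen_step (@incl_inj _ _ (lkernel g)) g_surj _ _ (IHi _ fgK)).
    by move=> y; rewrite -(lkernelP g); exact: inclP.
  exact: free_coboundary.
have augL : linear (fun h : Hom N X => class (augment_cocycle h)).
  move=> a h h'.
  have d := cocycleP a (augment_cocycle h) (augment_cocycle h').
  rewrite -(class_linear _ _ d); apply/class_eqP.
  by rewrite [X in X - _]linearP subrr; exact: is_coboundary0.
apply: (fin_gen_surj (f := mkLin augL)) (Hom_fin_gen fgN fgX) => z.
have [u [du ->]] := class_surj z; have [h hE] := cocycle0_factor du.
exists (lin_hom h); apply/class_eqP; rewrite [X in X - u](_ : _ = u).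
  by rewrite subrr; exact: is_coboundary0.
by apply: homE => x; rewrite hE.
Qed.

End ExtFinGen.

(** * Vanishing in all degrees *)

Section AllDegrees.
Variables (R : comNzRingType) (noethR : noetherian R) (p : Spec R).
Variable X : lmodType R.
Hypothesis fgX : fin_gen X.
Implicit Types V W N : lmodType R.

(** In degree 0 an element outside p that kills X kills Hom(N, X). Higher
    degrees follow by dimension shifting, which avoids asking how this
    element acts on an injective resolution of X. *)
Lemma Ext_zero_coeff : locally_zero p X ->
  forall i N, fin_gen N -> Ext_zero p X i N.
Proof.
move=> /(locally_zero_fin_gen fgX)[s sp /annihP sX]; elim=> [|i IHi] N fgN.
  apply/Ext_zeroP => u du; exists s => //; have [h hE] := cocycle0_factor du.
  apply: homE => x; apply: etrans (homZE s u x) _.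
  by rewrite hE -linearZ_LR sX linear0.
have [m [g [g_surj fgK]]] := presentation noethR fgN.
apply: (Ext_zero_image g_surj) => [j [<-]|]; first exact: IHi.
apply/Ext_zeroP => u du; exists 1; first by rewrite idealr1.
by rewrite scale1r; exact: free_coboundary du.
Qed.

Lemma scale_linear (x : R) V : linear (fun v : V => x *: v).
Proof. by move=> a u v; rewrite scalerDr !scalerA mulrC. Qed.

(** From 0 -> V -> V -> V / x V -> 0, with multiplication by x as first map:
    when Ext^(i+1)(V / x V, X) vanishes at p, multiplication by x is onto on
    Ext^i(V, X) at p, and Ext^i(V, X) is finitely generated, so Nakayama's
    lemma applies. *)
Lemma Ext_zero_of_scale i V (x : R) : fin_gen V -> x \in (p : pred R) ->
  (forall v : V, x *: v = 0 -> v = 0) ->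
  Ext_zero p X i.+1 (quotm (limage (mkLin (scale_linear x (V := V))))) ->
  Ext_zero p X i V.
Proof.
move=> fgV xp x_reg C0; pose f := mkLin (scale_linear x (V := V)).
have f_inj : injective f by apply: raddf_inj => v; exact: x_reg.
have f_exact y : proj (limage f) y = 0 <-> exists v, y = f v.
  by rewrite proj0P; exact: limageP.
apply: (@nakayama _ _ _ (multiples (x : R^o))).
- exact: Ext_fin_gen.
- by move=> r /multiplesP[s ->]; rewrite /GRing.scale /= idealMr.
move=> z; have [u [du ->]] := class_surj z.
have [v [dv uv]] := connects_total (@resolution_injective _ X) f_inj
  (@proj_surj _ _ (limage f)) f_exact du.
have [s sp sv] := (Ext_zeroP _ _ _ _).1 C0 v dv; exists s => //.
have [w [dw fw]] := exact_left f_exact (connectsZ s uv) sv.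
apply: span_gen; exists x, (class dw); split=> //.
  by apply/multiplesP; exists 1; rewrite scale1r.
rewrite -(classZ du (cocycleZ s du)) -(classZ dw (cocycleZ x dw)).
apply/class_eqP; rewrite -fw [X in X - _](_ : _ = x *: w).
  by rewrite subrr; exact: is_coboundary0.
apply: homE => y; apply: etrans (esym (homZE x w y)).
exact: (linearZ_LR (mkLin (homP w)) x y).
Qed.

(** A finitely generated module whose depth at p is infinite vanishes at p.
    By devissage Ext^i(V, X) vanishes at p for every finitely generated V.
    For a cyclic V with prime annihilator q: if q is not inside p, an
    element of q outside p kills V; if q = p, the support of V lies in that
    of N; and if q is strictly inside p, [Ext_zero_of_scale] applies with
    any x in p outside q. The choice V = R gives X. *)
Lemma Ext_zero_all N : fin_gen N ->
  contained (annih N) p ->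
  (forall i, Ext_zero p X i N) -> locally_zero p X.
Proof.
move=> fgN Np N0.
have Ext0 : forall V, fin_gen V -> forall i, Ext_zero p X i V.
  apply: (devissage noethR (Q := fun V => forall i, Ext_zero p X i V)) =>
    [V V0 i|V S S0 Q0 i|q V c cV cq IHV i].
  - apply: (@Ext_zero_annih _ _ _ _ _ 1); first by rewrite idealr1.
    by apply/annihP => x; exact: V0.
  - by apply: (Ext_zero_extension (S := S)); [exact: S0|exact: Q0].
  have q_annih (r : R) : r \in (q : pred R) -> r \in annih V.
    move=> /cq rc; apply/annihP => v; have [s ->] := cV v.
    by rewrite scalerA mulrC -scalerA rc scaler0.
  have [qp|/existsNP[s /not_implyP[sq /negP sp]]] :=
      pselect (forall r : R, r \in (q : pred R) -> r \in (p : pred R));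
    last first.
    by apply: (Ext_zero_annih sp); exact: q_annih.
  have [pq|/existsNP[x /not_implyP[xp xq]]] :=
      pselect (forall r : R, r \in (p : pred R) -> r \in (q : pred R)).
    apply: (Ext_zero_support noethR fgN (n := i)) => //.
      exact: generates_fin_gen cV.
    by move=> q' Vq' r /Np/pq/q_annih; exact: Vq'.
  apply: (Ext_zero_of_scale (generates_fin_gen cV) xp) => [v xv|].
    have [r vr] := cV v; move: xv; rewrite vr scalerA => /cq.
    by rewrite prime_idealrM => /orP[/xq//|/cq].
  apply: (IHV _ (proj _ c)).
  - exact: generates_surj (@proj_surj _ _ _) cV.
  - by move=> r /cq rc; rewrite -linearZ rc linear0.
  - exists x; first exact/negP.
    by rewrite -linearZ; apply/proj0P/limageP; exists c.
move=> x; have xL : linear (fun r : R^o => (r : R) *: x).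
  by move=> a r s; rewrite scalerDl -scalerA.
pose u := hom_map (iaug (can_resolution X)) idfun (lin_hom (mkLin xL)).
have uE : val u (1 : R^o) = iaug (can_resolution X) x.
  exact: congr1 (scale1r x).
have [s sp su] := (Ext_zeroP _ _ _ _).1 (Ext0 _ (@fin_gen_regular R) 0%N) u
  (augment_cocycle _).
have su0 : s *: u = 0 by exact: su.
exists s => //; apply: (@iaug_inj _ _ (can_resolution X)).
rewrite linearZ_LR linear0 -uE; apply: etrans (esym (homZE s u _)) _.
by rewrite su0.
Qed.

End AllDegrees.

(** * Closed subsets of the spectrum *)

Section Spectrum.
Variable R : comNzRingType.
Implicit Types (V : lmodType R) (a b : ideal R).

Lemma idealD_contained a b q :
  contained (idealD a b) q <-> contained a q /\ contained b q.
Proof.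
split=> [abq|[aq bq] r].
  by split=> r rI; apply: abq; apply: span_gen; [left|right].
have q0 : (fun r : R^o => r \in (q : pred R)) 0 by exact: rpred0.
have qD (c : R) (x y : R^o) : x \in (q : pred R) -> y \in (q : pred R) ->
    c *: x + y \in (q : pred R).
  by move=> xq yq; apply: rpredD => //; exact: idealMr.
move=> rab; apply/(submod_ofP q0 qD); apply: (span_min _ rab) => s sab.
by apply/(submod_ofP q0 qD); case: sab => [/aq|/bq].
Qed.

Lemma zariski_closedU (Y Z : set (Spec R)) :
  zariski_closed Y -> zariski_closed Z -> zariski_closed (Y `|` Z).
Proof.
move=> [a ->] [b ->]; pose P (r : R^o) := r \in a /\ r \in b.
have P0 : P 0 by split; exact: rpred0.
have PD (c : R) (x y : R^o) : P x -> P y -> P (c *: x + y).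
  by move=> [xa xb] [ya yb]; split; apply: rpredD => //; exact: rpredZ.
exists (submod_of P0 PD); apply/seteqP; split=> q.
  by move=> [aq|bq] r /(submod_ofP P0 PD)[ra rb]; [exact: aq|exact: bq].
move=> abq.
have [aq|/existsNP[r /not_implyP[ra rq]]] := pselect (contained a q).
  by left.
right=> s sb; have : r * s \in (q : pred R).
  apply: abq; apply/(submod_ofP P0 PD); split; last exact: (rpredZ r sb).
  by rewrite mulrC; exact: (rpredZ s ra).
by rewrite prime_idealrM => /orP[/rq|].
Qed.

Lemma zariski_closed_bigcup (F : nat -> set (Spec R)) n :
  (forall i, zariski_closed (F i)) ->
  zariski_closed (\bigcup_(i in [set i | (i <= n)%N]) F i).
Proof.
move=> Fc; elim: n => [|n IHn].
  rewrite (_ : \bigcup_(i in _) _ = F 0%N)//; apply/seteqP; split=> q.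
    by move=> [i]; rewrite /= leqn0 => /eqP ->.
  by exists 0%N.
rewrite (_ : \bigcup_(i in _) _ =
    \bigcup_(i in [set i | (i <= n)%N]) F i `|` F n.+1).
  exact: zariski_closedU.
apply/seteqP; split=> q [].
- move=> i; rewrite /= leq_eqVlt ltnS => /predU1P[->|ilen] Fi; first by right.
  by left; exists i.
- by move=> [i /= ilen Fi]; exists i => //=; exact: leqW.
- by exists n.+1 => /=.
Qed.

Lemma Supp_closed V : fin_gen V -> zariski_closed (Supp V).
Proof.
move=> fgV; exists (annih V : ideal R); apply/seteqP; split=> q; last first.
  move=> Vq; apply: contrapT => /notSuppP /(locally_zero_fin_gen fgV)[s sq].
  by move/Vq => qs; rewrite qs in sq.
move=> qV r rV; apply: contraT => rq; exfalso; move: qV.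
by apply/notSuppP; exact: locally_zero_annih rV.
Qed.

Lemma notin_bigcup_Supp (F : nat -> lmodType R) (J : set nat) q :
  ~ (\bigcup_(i in J) Supp (F i)) q <-> forall i, J i -> locally_zero q (F i).
Proof.
split=> [nq i Ji|F0 [i Ji]]; first by apply/notSuppP => qi; apply: nq; exists i.
exact/notSuppP/F0.
Qed.

Lemma bigcup_Supp_eq (F G : nat -> lmodType R) (J : set nat) :
  (forall q, (forall i, J i -> locally_zero q (F i)) <->
     (forall i, J i -> locally_zero q (G i))) ->
  \bigcup_(i in J) Supp (F i) = \bigcup_(i in J) Supp (G i).
Proof.
move=> FG; apply/seteqP; split=> q qF; apply: contrapT => nq; move: qF;
by apply/notin_bigcup_Supp/FG/notin_bigcup_Supp.
Qed.

End Spectrum.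

(** If there is a largest degree with nonzero local cohomology, it is the
    cohomological dimension. Otherwise the supremum is +oo. *)
Lemma le_cd (R : comNzRingType) (a : ideal R) (X : lmodType R) i :
  nonzero (loc_coh i a X) -> (i%:Z%:E <= cd a X)%E.
Proof.
move=> i0.
have [[c [c0 cmax]]|nmax] := pselect (exists c, nonzero (loc_coh c a X) /\
    forall j, nonzero (loc_coh j a X) -> (j <= c)%N).
  by rewrite (cd_largest c0 cmax) lee_fin lez_nat cmax.
have unbounded m : exists2 j, nonzero (loc_coh j a X) & (m <= j)%N.
  elim: m => [|m [j j0 mj]]; first by exists i.
  apply: contrapT => nm; apply: nmax; exists j; split=> // k k0.
  rewrite leqNgt; apply/negP => jk; apply: nm; exists k => //.
  exact: leq_ltn_trans jk.
rewrite /cd /supremum; case: eqP => [e|_].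
  by suff : set0 (i%:Z%:E : \bar int); [|rewrite -e; exists i].
have ooS : supremums [set j%:Z%:E | j in [set j | nonzero (loc_coh j a X)]]
    (+oo%E : \bar int).
  split=> [y _|y yub]; first exact: leey.
  case: y yub => [r|//|] yub; last by have := yub _ (ex_intro2 _ _ i i0 erefl).
  have [j j0 rj] := unbounded (`|r|%N.+1).
  have := yub _ (ex_intro2 _ _ j j0 erefl); rewrite lee_fin => jr.
  have := le_trans jr (ler_norm r); rewrite -abszE lez_nat leqNgt.
  by rewrite rj.
have [+ _] := xgetPex -oo%E (ex_intro _ _ ooS); apply; exists i => //.
Qed.

Section Comparison.
Variables (R : comNzRingType) (noethR : noetherian R).
Variables (a : ideal R) (M X : lmodType R).
Hypothesis fgM : fin_gen M.

Let b := idealD a (annih M).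

Lemma annih_quotient_sum q :
  contained (annih (quotm (idealM a M))) q <-> contained b q.
Proof.
apply: iff_trans (annih_quotient q a fgM) _.
exact: iff_sym (idealD_contained _ _ _).
Qed.

Lemma annih_cyclic q :
  contained (annih (quotm (idealM b R^o))) q <-> contained b q.
Proof.
apply: iff_trans (annih_quotient q b (@fin_gen_regular R)) _.
split=> [[]//|bq]; split=> // r /annihP/(_ (1 : R^o)).
by rewrite /GRing.scale /= mulr1 => ->; exact: rpred0.
Qed.

Lemma bigcup_Supp_Ext n :
  \bigcup_(i in [set i | (i <= n)%N]) Supp (gen_loc_coh i a M X) =
  \bigcup_(i in [set i | (i <= n)%N]) Supp (Ext i (quotm (idealM a M)) X).
Proof. by apply: bigcup_Supp_eq => q; exact: gen_loc_coh_zeroP. Qed.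

Lemma bigcup_Supp_loc_coh n :
  \bigcup_(i in [set i | (i <= n)%N]) Supp (gen_loc_coh i a M X) =
  \bigcup_(i in [set i | (i <= n)%N]) Supp (loc_coh i b X).
Proof.
have fgMa : fin_gen (quotm (idealM a M)) by exact: fin_gen_quotm.
have fgRb : fin_gen (quotm (idealM b R^o)).
  exact/fin_gen_quotm/fin_gen_regular.
apply: bigcup_Supp_eq => q.
apply: iff_trans (gen_loc_coh_zeroP noethR q a X fgM n) _.
apply: iff_trans (iff_sym
  (gen_loc_coh_zeroP noethR q b X (@fin_gen_regular R) n)).
split=> E0.
  apply: (Ext_zero_support noethR fgMa E0 fgRb) => q'.
  by move=> /annih_cyclic/annih_quotient_sum.
apply: (Ext_zero_support noethR fgRb E0 fgMa) => q'.
by move=> /annih_quotient_sum/annih_cyclic.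
Qed.

(** The union over all degrees is the intersection of V(a), Supp M and Supp
    X. If q lies in Supp (M / a M) and all Ext^i(M / a M, X) vanish at q,
    then X vanishes at q by [Ext_zero_all]; outside Supp (M / a M) or Supp X
    all these Ext vanish. *)
Lemma bigcup_all_Supp : fin_gen X ->
  \bigcup_(i in [set: nat]) Supp (gen_loc_coh i a M X) =
  [set q | contained (idealD b (annih X)) q].
Proof.
move=> fgX.
have fgMa : fin_gen (quotm (idealM a M)) by exact: fin_gen_quotm.
have H0P q : (forall i, locally_zero q (gen_loc_coh i a M X)) <->
    (forall i, Ext_zero q X i (quotm (idealM a M))).
  split=> H0 i.
    exact: ((gen_loc_coh_zeroP noethR q a X fgM i).1 (fun j _ => H0 j)).
  exact: ((gen_loc_coh_zeroP noethR q a X fgM i).2 (fun j _ => H0 j)).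
apply/seteqP; split=> q.
  move=> qH; apply/idealD_contained; split=> [|r rX]; last first.
    apply: contraT => rq; exfalso; move: qH; apply/notin_bigcup_Supp => i _.
    apply: (H0P q).2 => {}i; apply: Ext_zero_coeff => //.
    exact: locally_zero_annih rX.
  apply/annih_quotient_sum => r rMa; apply: contraT => rq; exfalso; move: qH.
  apply/notin_bigcup_Supp => i _; apply: (H0P q).2 => {}i.
  exact: Ext_zero_annih rMa.
move=> /idealD_contained[/annih_quotient_sum qM qX]; apply: contrapT.
move=> /notin_bigcup_Supp H0.
have := Ext_zero_all noethR fgX fgMa qM ((H0P q).1 (fun i => H0 i I)).
by move=> /(locally_zero_fin_gen fgX)[s sq /qX qs]; rewrite qs in sq.
Qed.

End Comparison.

Theorem corollary3p6 (R : comNzRingType) (a : ideal R) (M X : lmodType R)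
    (n : nat) (noethR : noetherian R) (fgM : fin_gen M) :
  [/\ \bigcup_(i in [set i | (i <= n)%N]) Supp (gen_loc_coh i a M X) =
      \bigcup_(i in [set i | (i <= n)%N])
        Supp (loc_coh i (idealD a (annih M)) X),
      \bigcup_(i in [set i | (i <= n)%N]) Supp (gen_loc_coh i a M X) =
      \bigcup_(i in [set i | (i <= n)%N]) Supp (Ext i (quotm (idealM a M)) X),
      fin_gen X -> zariski_closed
        (\bigcup_(i in [set i | (i <= n)%N]) Supp (gen_loc_coh i a M X)),
      fin_gen X -> zariski_closed
        (\bigcup_(i in [set: nat]) Supp (gen_loc_coh i a M X)) &
      Supp (gen_loc_coh n a M X) `<=`
      \bigcup_(i in [set i : nat | (i%:Z%:E <= cd (idealD a (annih M)) X)%E])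
        Supp (gen_loc_coh i a M X)].
Proof.
split=> [||fgX|fgX|q qn].
- exact: bigcup_Supp_loc_coh.
- exact: bigcup_Supp_Ext.
- rewrite bigcup_Supp_Ext//; apply: zariski_closed_bigcup => i.
  by apply/Supp_closed/Ext_fin_gen => //; exact: fin_gen_quotm.
- by rewrite bigcup_all_Supp//; exists (idealD (idealD a (annih M)) (annih X)).
have supp_eq m := bigcup_Supp_loc_coh noethR a X fgM m.
have [i _ qi] : (\bigcup_(i in [set i | (i <= n)%N])
    Supp (loc_coh i (idealD a (annih M)) X)) q.
  by rewrite -supp_eq; exists n => /=.
have [j /= ji qj] : (\bigcup_(j in [set j | (j <= i)%N])
    Supp (gen_loc_coh j a M X)) q.
  by rewrite supp_eq; exists i => /=.
exists j => //=.
apply: (@le_trans _ _ (i%:Z%:E : \bar int)); first by rewrite lee_fin lez_nat.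
apply: le_cd; apply: contrapT => i0; move: qi; apply/notSuppP => z.
exists 1; first by rewrite idealr1.
by rewrite scale1r; apply: contrapT => /eqP z0; apply: i0; exists z.
Qed.
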